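(* Let $\mathcal{G}$ be a metric graph which is hyperbolic relative to a family $\mathcal{H}=\{H_c\mid c\in\mathcal{C}\}$ of complete connected subgraphs. If there is a number $\delta>0$ such that each of the graphs $H_c$, with its intrinsic path metric, is $\delta$-hyperbolic, then: (i) $\mathcal{G}$ is hyperbolic; (ii) enlargements of geodesics in the $\mathcal{H}$-electrification $\mathcal{EG}$ (with endpoints in $\mathcal{G}$) are uniform quasi-geodesics in $\mathcal{G}$, i.e. there is a number $L'\geq 1$ such that every enlargement of every such geodesic is an $L'$-quasi-geodesic in $\mathcal{G}$; (iii) the subgraphs $H_c$ are uniformly quasi-convex in $\mathcal{G}$, i.e. there is $k>0$ such that every $H_c$ is $k$-quasi-convex.
   Context: A metric graph is a connected graph, not necessarily locally finite, with all edges of length one, equipped with the path metric. The index set $\mathcal{C}$ is countable, finite or empty. A complete subgraph is a full subgraph: it contains every edge of the ambient graph joining two of its vertices. Each $H_c$ carries its intrinsic path metric. Electrification: the $\mathcal{H}$-electrification $\mathcal{EG}$ of $\mathcal{G}$ is the metric graph obtained from $\mathcal{G}$ by adding for every $c\in\mathcal{C}$ one new vertex $v_c$, which is connected to each vertex of $H_c$ by an edge of length one and is not connected to any other vertex. Paths: all parametrized paths in $\mathcal{G}$ or $\mathcal{EG}$ are simplicial: the image of each integer is a vertex, and the image of each interval $[k,k+1]$ with $k\in\mathbb{Z}$ is an edge or a single vertex. A simplicial path $\gamma$ in $\mathcal{EG}$ is efficient if for every $c\in\mathcal{C}$ we have $\gamma(k)=v_c$ for at most one $k$. An $L$-quasi-geodesic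 is a path $\gamma$ with $|s-t|/L-L\le d(\gamma(s),\gamma(t))\le L|s-t|+L$ for all $s,t$ in its domain. Bounded penetration: $\mathcal{H}$ has the bounded penetration property if for every $L>0$ there is a number $p(L)>0$ with the following property. Let $\gamma$ be an efficient $L$-quasi-geodesic in $\mathcal{EG}$, let $c\in\mathcal{C}$ and let $k\in\mathbb{Z}$ be such that $\gamma(k)=v_c$. If the distance in $H_c$ between $\gamma(k-1)$ and $\gamma(k+1)$ is at least $p(L)$, then every efficient $L$-quasi-geodesic $\gamma'$ in $\mathcal{EG}$ with the same endpoints as $\gamma$ passes through $v_c$; moreover, if $\gamma'(k')=v_c$, then the distance in $H_c$ between $\gamma(k-1)$ and $\gamma'(k'-1)$ and the distance in $H_c$ between $\gamma(k+1)$ and $\gamma'(k'+1)$ are at most $p(L)$. Relative hyperbolicity: $\mathcal{G}$ is hyperbolic relative to $\mathcal{H}$ if $\mathcal{EG}$ is hyperbolic in the sense of Gromov and $\mathcal{H}$ has the bounded penetration property. Enlargement: let $\gamma:[0,n]\to\mathcal{EG}$ be an efficient simplicial quasi-geodesic with $\gamma(0),\gamma(n)\in\mathcal{G}$, and let $0<k_1<\dots<k_s<n$ be those points with $\gamma(k_i)=v_{c_i}$ for some $c_i\in\mathcal{C}$; then $\gamma(k_i-1),\gamma(k_i+1)\in H_{c_i}$. An enlargement $\hat\gamma$ of $\gamma$ is a path in $\mathcal{G}$ obtained by replacing, for each $i$, $\gamma[k_i-1,k_i+1]$ by a simplicial geodesic in $H_{c_i}$ with the same endpoints. Quasi-convexity: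 a subset $Z$ of $\mathcal{G}$ is $k$-quasi-convex if any geodesic in $\mathcal{G}$ with both endpoints in $Z$ is contained in the $k$-neighborhood of $Z$. *)

(* Defs.v *)
From Stdlib Require Export Reals List.
From Coquelicot Require Export Rbar Lub.
Open Scope R_scope.

Set Implicit Arguments.

(** * Metric graphs *)

(** Graphs are simple and unoriented; no finiteness is assumed. *)
Record graph := Graph {
  vert : Type;
  adj : vert -> vert -> Prop;
  adj_sym : forall x y, adj x y -> adj y x;
  adj_irrefl : forall x, ~ adj x x
}.

Inductive walk (G : graph) : nat -> vert G -> vert G -> Prop :=
| walk_nil x : walk G 0 x x
| walk_cons n x y z : adj G x y -> walk G n y z -> walk G (S n) x z.

Definition connected (G : graph) : Prop :=
  inhabited (vert G) /\ forall x y : vert G, exists n, walk G n x y.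

(** A point of the geometric realization of [G], all edges having length one:
    the point at distance [pos] from [src] on the edge from [src] to [tgt], or
    the vertex [src] when [src = tgt].  Vertices and points of edges have
    several representatives; they are at distance zero from each other for
    [dist] below, and every notion used here is insensitive to the choice. *)
Record point (G : graph) := Point {
  src : vert G;
  tgt : vert G;
  pos : R;
  point_edge : src = tgt \/ adj G src tgt;
  point_pos : 0 <= pos <= 1
}.

Definition vertex_point (G : graph) (x : vert G) : point G :=
  @Point G x x 0 (or_introl eq_refl) (conj (Rle_refl 0) Rle_0_1).

(** [exit p x a]: from [p] one reaches the vertex [x] by moving a length [a]
    inside the edge (or vertex) carrying [p]. *)
Definition exit (G : graph) (p : point G) (x : vert G) (a : R) : Prop :=
  (x = src p /\ a = pos p) \/
  (x = tgt p /\ a = 1 - pos p) \/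
  (src p = tgt p /\ x = src p /\ a = 0).

(** Lengths of paths from [p] to [q] in the realization: either the path goes
    through vertices, or it stays inside one edge, which [p] and [q] may
    traverse in the same or in opposite directions. *)
Definition path_length (G : graph) (p q : point G) (r : R) : Prop :=
  (exists x y a b n,
     exit p x a /\ exit q y b /\ walk G n x y /\ r = a + INR n + b) \/
  (src p = src q /\ tgt p = tgt q /\ r = Rabs (pos p - pos q)) \/
  (src p = tgt q /\ tgt p = src q /\ r = Rabs (pos p - (1 - pos q))).

(** The path metric.  The infimum is finite when [G] is connected. *)
Definition dist (G : graph) (p q : point G) : R :=
  real (Glb_Rbar (path_length p q)).

Definition vdist (G : graph) (x y : vert G) : R :=
  dist (vertex_point G x) (vertex_point G y).

(** * Hyperbolicity in the sense of Gromov *)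

Definition gromov_product (G : graph) (x y w : point G) : R :=
  (dist x w + dist y w - dist x y) / 2.

Definition delta_hyperbolic (G : graph) (delta : R) : Prop :=
  forall w x y z : point G,
    Rmin (gromov_product x y w) (gromov_product y z w) - delta
      <= gromov_product x z w.

Definition hyperbolic (G : graph) : Prop :=
  exists delta, delta_hyperbolic G delta.

(** * Simplicial paths *)

(** A simplicial path on [[0, len]], given by its values at the integers and
    extended by a constant beyond [len]. *)
Record path (G : graph) := Path {
  len : nat;
  at_nat :> nat -> vert G;
  path_step : forall k, at_nat k = at_nat (S k) \/ adj G (at_nat k) (at_nat (S k));
  path_stop : forall k, (len <= k)%nat -> at_nat k = at_nat len
}.

Lemma frac_part_bounds (t : R) : 0 <= frac_part t <= 1.
Proof.
destruct (base_fp t) as [H0 H1]; split;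
  [exact (Rge_le _ _ H0) | exact (Rlt_le _ _ H1)].
Qed.

(** The value at a real parameter [t >= 0]; an edge is traversed at unit
    speed. *)
Definition at_real (G : graph) (g : path G) (t : R) : point G :=
  let k := Z.to_nat (Int_part t) in
  @Point G (g k) (g (S k)) (frac_part t) (path_step g k) (frac_part_bounds t).

Definition path_vertices (G : graph) (g : path G) : list (vert G) :=
  map g (seq 0 (S (len g))).

Definition quasi_geodesic (G : graph) (L : R) (g : path G) : Prop :=
  forall s t, 0 <= s <= INR (len g) -> 0 <= t <= INR (len g) ->
    Rabs (s - t) / L - L <= dist (at_real g s) (at_real g t)
      <= L * Rabs (s - t) + L.

Definition geodesic (G : graph) (g : path G) : Prop :=
  forall s t, 0 <= s <= INR (len g) -> 0 <= t <= INR (len g) ->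
    dist (at_real g s) (at_real g t) = Rabs (s - t).

(** * Complete subgraphs and electrification *)

(** The complete subgraph with vertex set [P]. *)
Definition full_subgraph (G : graph) (P : vert G -> Prop) : graph :=
  @Graph {x : vert G | P x}
    (fun x y => adj G (proj1_sig x) (proj1_sig y))
    (fun x y => adj_sym G (proj1_sig x) (proj1_sig y))
    (fun x => adj_irrefl G (proj1_sig x)).

Definition inclusion (G : graph) (P : vert G -> Prop)
  (x : vert (full_subgraph G P)) : vert G := proj1_sig x.

(** The points of the realization of [G] lying on that of
    [full_subgraph G P]: every end of the carrying edge that has positive
    barycentric weight belongs to [P]. *)
Definition subgraph_points (G : graph) (P : vert G -> Prop) (p : point G) : Prop :=
  (pos p < 1 -> P (src p)) /\ (0 < pos p -> P (tgt p)).

Section Electrification.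
Variables (G : graph) (C : Type) (H : C -> vert G -> Prop).

(** [inl x] is the vertex [x] of [G]; [inr c] is the new vertex [v_c]. *)
Definition el_adj (u v : vert G + C) : Prop :=
  match u, v with
  | inl x, inl y => adj G x y
  | inl x, inr c | inr c, inl x => H c x
  | inr _, inr _ => False
  end.

Lemma el_adj_sym u v : el_adj u v -> el_adj v u.
Proof. destruct u, v; simpl; auto; apply adj_sym. Qed.

Lemma el_adj_irrefl u : ~ el_adj u u.
Proof. destruct u; simpl; auto; apply adj_irrefl. Qed.

Definition electrification : graph := Graph el_adj el_adj_sym el_adj_irrefl.

Definition efficient (g : path electrification) : Prop :=
  forall (c : C) (i j : nat), (i <= len g)%nat -> (j <= len g)%nat ->
    g i = inr c -> g j = inr c -> i = j.

(** [visits g k x y]: the path [g] is at [v_c] at time [k + 1], coming from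
    the vertex [x] of [H_c] and leaving to the vertex [y] of [H_c].  If [g] is
    efficient, every visit to [v_c] at a time other than [0] and [len g] is of
    this form. *)
Definition visits (g : path electrification) (c : C) (k : nat)
    (x y : vert (full_subgraph G (H c))) : Prop :=
  (S (S k) <= len g)%nat /\
  g k = inl (@inclusion G (H c) x) /\ g (S k) = inr c /\
  g (S (S k)) = inl (@inclusion G (H c) y).

(** The endpoints of [g'] differ from [v_c], since [g] is efficient and is at
    [v_c] at an interior time; so [visits] covers every [k'] with
    [g' k' = v_c]. *)
Definition bounded_penetration : Prop :=
  forall L, 0 < L -> exists p, 0 < p /\
  forall g : path electrification, efficient g -> quasi_geodesic L g ->
  forall c k (x y : vert (full_subgraph G (H c))), visits g k x y ->
    p <= vdist (full_subgraph G (H c)) x y ->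
  forall g' : path electrification, efficient g' -> quasi_geodesic L g' ->
    g' 0%nat = g 0%nat -> g' (len g') = g (len g) ->
    (exists k', (k' <= len g')%nat /\ g' k' = inr c) /\
    (forall k' (x' y' : vert (full_subgraph G (H c))), visits g' k' x' y' ->
       vdist (full_subgraph G (H c)) x x' <= p /\
       vdist (full_subgraph G (H c)) y y' <= p).

Definition relatively_hyperbolic : Prop :=
  hyperbolic electrification /\ bounded_penetration.

(** [enlarged s l]: the vertex sequence [l] in [G] arises from the vertex
    sequence [s] in the electrification by replacing each segment
    [x, v_c, y] by a simplicial geodesic of [H_c] from [x] to [y]. *)
Inductive enlarged : list (vert electrification) -> list (vert G) -> Prop :=
| enlarged_end x : enlarged (inl x :: nil) (x :: nil)
| enlarged_step x v s l :
    enlarged (inl v :: s) l -> enlarged (inl x :: inl v :: s) (x :: l)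
| enlarged_cone c (b : path (full_subgraph G (H c))) s l :
    geodesic b ->
    enlarged (inl (@inclusion G (H c) (b (len b))) :: s) l ->
    enlarged
      (inl (@inclusion G (H c) (b 0%nat)) :: inr c
         :: inl (@inclusion G (H c) (b (len b))) :: s)
      (map (@inclusion G (H c)) (path_vertices b) ++ tl l).

Definition enlargement (g : path electrification) (h : path G) : Prop :=
  enlarged (path_vertices g) (path_vertices h).

End Electrification.

(** * Quasi-convexity *)

(** Geodesics are not required here to be simplicial or to join vertices. *)
Definition quasi_convex (G : graph) (k : R) (A : point G -> Prop) : Prop :=
  forall (l : R) (g : R -> point G), 0 <= l ->
    (forall s t, 0 <= s <= l -> 0 <= t <= l ->
       dist (g s) (g t) = Rabs (s - t)) ->
    A (g 0) -> A (g l) ->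
    forall t, 0 <= t <= l -> exists a, A a /\ dist (g t) a <= k.

Definition countable (T : Type) : Prop :=
  exists f : T -> nat, forall a b, f a = f b -> a = b.

(* Main.v *)
Require Import Defs.
From Stdlib Require Import Lia Lra ZArith Classical ClassicalEpsilon.

(**
The distance between vertices of a graph is treated as a natural number
[dn], and hyperbolicity as the four-point inequality [four_point]; the metric
of the realization differs from it by bounded amounts.

Bounded penetration enters only through [detours_bounded]: if two vertices of
[H_c] are joined in [EG] by a path of length at most [K] that avoids the cone
vertex [v_c], then their distance in [H_c] is bounded in terms of [K]. Let the
projection of [x] to [H_c] be the last vertex before [v_c] on a geodesic from
[x] to [v_c]. In the hyperbolic graph [EG], two geodesics ending at [v_c] and
starting at the ends of a geodesic [x y] that avoids [v_c] can be joined by a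
short path avoiding [v_c]. Hence [x] and [y] have nearby projections
([bounded_geodesic_image]). In particular projections to [H_c] are well
defined up to bounded error, and they are coarsely Lipschitz on [G].

For vertices [x] and [y] of [G] let [hull x y] be the union of the enlargements
of the geodesics of [EG] from [x] to [y]. These sets form slim triangles
([hull_slim]). A point of [hull x y] inside some [H_c] is handled by the
hyperbolicity of [H_c], applied to the projections of the three corners. A
point [u] on a geodesic of [EG] has a nearby point [w] of another side for the
metric of [EG]. If [u] and [w] are far apart in [G], a geodesic of [EG] between
them crosses some [v_c] with a large width; then the three corners do not all
have nearby projections to [H_c], so another side of the triangle passes
through [v_c], and its entry or exit point is near [u] in [G].

A family of connected sets with slim triangles forces hyperbolicity and
follows the geodesics. This is the guessing geodesics criterion of Masur and
Schleimer and of Bowditch ([guess_near_between], [guess_four_point]), and it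
yields (i). For (iii), a geodesic of [H_c] is contained in the hull of its
ends. For (ii), an enlargement is contained in a hull, so its points are almost
determined by their distances from its starting point. Moreover an enlargement
is properly embedded in [G] ([enlargement_proper]): between two points that
are close in [G] it crosses few cone vertices, and each of them with bounded
width, because projections are Lipschitz.
*)

(** * The combinatorial distance of a graph *)

Section CombinatorialDistance.
Local Open Scope nat_scope.

Lemma least_nat (P : nat -> Prop) :
  (exists n, P n) -> exists n, P n /\ forall m, P m -> n <= m.
Proof.
intros [n Pn]; revert Pn; induction n as [n IH] using lt_wf_ind; intros Pn.
destruct (classic (exists m, m < n /\ P m)) as [[m [lt_mn Pm]]|none].
- exact (IH m lt_mn Pm).
- exists n; split; [exact Pn|]; intros m Pm.
  destruct (le_lt_dec n m) as [|lt_mn]; [assumption|].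
  exfalso; apply none; exists m; auto.
Qed.

(** The metric of the realization between vertices, but with values in the
    natural numbers, so that metric inequalities become linear arithmetic. *)
Definition dn {X : graph} (x y : vert X) : nat :=
  epsilon (inhabits 0)
    (fun n => walk X n x y /\ forall m, walk X m x y -> n <= m).


Definition btw {X : graph} (x m y : vert X) : Prop := dn x m + dn m y = dn x y.

Section Walks.
Context {X : graph}.
Implicit Types x y z : vert X.

Lemma walk_app n m x y z : walk X n x y -> walk X m y z -> walk X (n + m) x z.
Proof.
induction 1; simpl; auto; intros w; econstructor; eauto.
Qed.

Lemma walk_edge x y : adj X x y -> walk X 1 x y.
Proof. intros a; econstructor; [exact a|constructor]. Qed.

Lemma walk_sym n x y : walk X n x y -> walk X n y x.
Proof.
induction 1 as [|n x y z a w IH]; [constructor|].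
replace (S n) with (n + 1) by lia.
apply (walk_app _ _ _ _ _ IH), walk_edge, adj_sym, a.
Qed.

Lemma dn_spec x y : (exists n, walk X n x y) ->
  walk X (dn x y) x y /\ forall m, walk X m x y -> dn x y <= m.
Proof. intros E; unfold dn; apply epsilon_spec, least_nat, E. Qed.

Lemma dn_le n x y : walk X n x y -> dn x y <= n.
Proof. intros w; apply dn_spec; eauto. Qed.

Lemma dn_refl x : dn x x = 0.
Proof. generalize (dn_le 0 x x (walk_nil X x)); lia. Qed.

Lemma dn_adj_le x y : adj X x y -> dn x y <= 1.
Proof. intros a; apply dn_le, walk_edge, a. Qed.

End Walks.

Section Connected.
Context {X : graph} (conn : connected X).
Implicit Types x y z : vert X.

Lemma dn_walk x y : walk X (dn x y) x y.
Proof. apply dn_spec, (proj2 conn). Qed.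

Lemma dn_sym x y : dn x y = dn y x.
Proof.
assert (le : forall x y, dn x y <= dn y x).
{ intros u v; apply dn_le, walk_sym, dn_walk. }
generalize (le x y) (le y x); lia.
Qed.

Lemma dn_tri x y z : dn x z <= dn x y + dn y z.
Proof. apply dn_le, walk_app with y; apply dn_walk. Qed.

Lemma dn_eq0 x y : dn x y = 0 -> x = y.
Proof. intros e; generalize (dn_walk x y); rewrite e; now inversion 1. Qed.

Lemma dn_eq1 x y : dn x y = 1 -> adj X x y.
Proof.
intros e; generalize (dn_walk x y); rewrite e; intros w.
inversion w as [|n x' z y' a w0]; subst.
inversion w0; subst; exact a.
Qed.

Lemma dn_adj x y : adj X x y -> dn x y = 1.
Proof.
intros a; generalize (dn_adj_le x y a); intros le.
destruct (dn x y) as [|[|n]] eqn:e; try lia.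
apply dn_eq0 in e; subst; destruct (adj_irrefl X _ a).
Qed.

Lemma dn_split x y i : i <= dn x y ->
  exists m, dn x m = i /\ dn m y = dn x y - i.
Proof.
assert (H : forall n x y, walk X n x y -> forall i, i <= n ->
          exists m, dn x m <= i /\ dn m y <= n - i).
{ clear i x y; induction 1 as [x|n x y z a w IH]; intros i le.
  - exists x; rewrite dn_refl; lia.
  - destruct i as [|i].
    + exists x; rewrite dn_refl; split; [lia|].
      apply dn_le; econstructor; eauto.
    + destruct (IH i) as [m [l1 l2]]; [lia|]; exists m.
      generalize (dn_tri x y m) (dn_adj_le x y a); lia. }
intros le; destruct (H _ _ _ (dn_walk x y) i le) as [m [l1 l2]].
exists m; generalize (dn_tri x m y); lia.
Qed.

Lemma dn_step x y : x <> y -> exists z, adj X x z /\ dn z y + 1 = dn x y.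
Proof.
intros ne; assert (0 < dn x y) as pos.
{ destruct (dn x y) eqn:e; [|lia]; destruct ne; now apply dn_eq0. }
destruct (dn_split x y 1 pos) as [z [e1 e2]].
exists z; split; [now apply dn_eq1|lia].
Qed.

Lemma dn_last x y : x <> y -> exists z, adj X z y /\ dn x z + 1 = dn x y.
Proof.
intros ne; destruct (dn_step y x) as [z [a e]]; [congruence|].
exists z; split; [now apply adj_sym|].
now rewrite (dn_sym x z), (dn_sym x y).
Qed.

Lemma btw_sym x m y : btw x m y -> btw y m x.
Proof.
unfold btw; rewrite (dn_sym y m), (dn_sym m x), (dn_sym y x); lia.
Qed.

End Connected.

(** ** Sets joined by edge paths *)

(** Unlike a parametrized path, [linked] carries no indices; arguments by
    connectedness along a path need none. *)
Inductive linked {X : graph} (S : vert X -> Prop) : vert X -> vert X -> Prop :=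
| linked_nil x : S x -> linked S x x
| linked_cons x y z : S x -> adj X x y -> linked S y z -> linked S x z.

Section Linked.
Context {X : graph}.
Implicit Types (x y z : vert X) (S T : vert X -> Prop).

Lemma linked_start S x y : linked S x y -> S x.
Proof. now destruct 1. Qed.

Lemma linked_end S x y : linked S x y -> S y.
Proof. now induction 1. Qed.

Lemma linked_sub S T x y : (forall u, S u -> T u) -> linked S x y -> linked T x y.
Proof. intros ST; induction 1; econstructor; eauto. Qed.

Lemma linked_app S x y z : linked S x y -> linked S y z -> linked S x z.
Proof. induction 1; auto; econstructor; eauto. Qed.

(** The discrete form of the connectedness of a path. *)
Lemma linked_cross S (Q : vert X -> Prop) x y : linked S x y -> Q x -> ~ Q y ->
  exists a b, S a /\ S b /\ adj X a b /\ Q a /\ ~ Q b.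
Proof.
induction 1 as [x Sx|x y z Sx a l IH]; intros Qx nQz; [contradiction|].
destruct (classic (Q y)) as [Qy|nQy]; [auto|].
exists x, y; repeat split; auto; eapply linked_start; eauto.
Qed.

Lemma linked_btw (conn : connected X) x y : linked (fun u => btw x u y) x y.
Proof.
remember (dn x y) as n eqn:e; revert x e; induction n as [|n IH]; intros x e.
- symmetry in e; apply (dn_eq0 conn) in e; subst; constructor.
  unfold btw; now rewrite !dn_refl.
- destruct (dn_step conn x y) as [z [a e1]].
  { intros ->; rewrite dn_refl in e; lia. }
  apply linked_cons with z; auto.
  + unfold btw; rewrite dn_refl; lia.
  + apply linked_sub with (2 := IH z ltac:(lia)); unfold btw; intros u b.
    generalize (dn_tri conn x z u) (dn_tri conn x u y) (dn_adj_le x z a); lia.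
Qed.

Lemma linked_level (conn : connected X) S x y t : linked S x y -> t <= dn x y ->
  exists u, S u /\ dn x u = t.
Proof.
intros l le; destruct (Nat.eq_dec t (dn x y)) as [->|ne].
{ exists y; split; auto; eapply linked_end; eauto. }
destruct (linked_cross S (fun u => dn x u <= t) x y l) as (a & b & Sa & _ & ab & ua & ub).
- rewrite dn_refl; lia.
- lia.
- exists a; split; auto.
  generalize (dn_tri conn x a b) (dn_adj_le a b ab); lia.
Qed.

End Linked.

Lemma walk_map {X Y : graph} (f : vert X -> vert Y) n x y :
  (forall u v, adj X u v -> adj Y (f u) (f v)) -> walk X n x y -> walk Y n (f x) (f y).
Proof. intros fa; induction 1; econstructor; eauto. Qed.

Lemma linked_map {X Y : graph} (f : vert X -> vert Y) (S : vert X -> Prop)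
    (T : vert Y -> Prop) x y :
  (forall u v, adj X u v -> adj Y (f u) (f v)) -> (forall u, S u -> T (f u)) ->
  linked S x y -> linked T (f x) (f y).
Proof. intros fa fS; induction 1; econstructor; eauto. Qed.

(** ** The four-point condition *)

Definition four_point (X : graph) (D : nat) : Prop :=
  forall x y z w : vert X,
    dn x y + dn z w <= dn x z + dn y w + D \/
    dn x y + dn z w <= dn x w + dn y z + D.

Section FourPoint.
Context {X : graph} (conn : connected X) (D : nat) (hyp : four_point X D).
Implicit Types x y z u w : vert X.

(** Fellow travelling. In the four-point inequality for the pairs [u, w] and
    [x, y], both sums on the right are at most the length from [x] to [y] plus
    the difference of the levels of [u] and [w] and the error [C]. *)
Lemma four_point_same_level x y u w C :
  dn x u + dn u y <= dn x y + C -> dn x w + dn w y <= dn x y + C ->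
  dn u w <= (if le_lt_dec (dn x u) (dn x w) then dn x w - dn x u
             else dn x u - dn x w) + C + D.
Proof.
intros hu hw.
destruct (hyp u w x y) as [h|h];
  generalize (dn_sym conn x u) (dn_sym conn x w); destruct le_lt_dec; lia.
Qed.

(** Stability: compare [w] with a vertex of the path on the same level. *)
Lemma four_point_linked_near S x y w C :
  (forall u, S u -> dn x u + dn u y <= dn x y + C) -> linked S x y ->
  dn x w + dn w y <= dn x y + C -> exists u, S u /\ dn u w <= 2 * C + D.
Proof.
intros hS l hw.
destruct (le_lt_dec (dn x w) (dn x y)) as [le|lt].
- destruct (linked_level conn S x y _ l le) as (u & Su & e).
  exists u; split; auto.
  generalize (four_point_same_level x y u w C (hS u Su) hw).
  destruct le_lt_dec; lia.
- exists y; split; [eapply linked_end; eauto|].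
  rewrite (dn_sym conn y w); lia.
Qed.

(** The four-point inequality puts [u] nearly between [z] and one of the ends;
    comparison with the vertex of the same level on an exact geodesic turns
    this into closeness to that side. *)
Lemma four_point_thin x y z u : btw x u y ->
  exists w, (btw x w z \/ btw z w y) /\ dn u w <= 2 * D.
Proof.
unfold btw; intros b.
assert (H : forall p q, dn u p + dn u q <= dn p q + D ->
          exists w, btw p w q /\ dn u w <= 2 * D).
{ intros p q h.
  destruct (le_lt_dec (dn p u) (dn p q)) as [le|lt].
  - destruct (dn_split conn p q (dn p u) le) as (w & e1 & e2).
    exists w; split; [unfold btw; lia|].
    generalize (dn_sym conn p u) (dn_sym conn p w).
    destruct (hyp u w p q); lia.
  - exists q; split; [unfold btw; rewrite dn_refl; lia|].
    generalize (dn_sym conn p u); lia. }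
generalize (dn_sym conn x u) (dn_sym conn y z) (dn_sym conn x z).
destruct (hyp u z x y) as [h|h]; intros s1 s2 s3.
- destruct (H z y) as (w & bw & dw); [lia|]; exists w; auto.
- destruct (H x z) as (w & bw & dw); [lia|]; exists w; auto.
Qed.

End FourPoint.

End CombinatorialDistance.

(** * Guessing geodesics *)

Section Guessing.
Local Open Scope nat_scope.

Lemma square_le_pow2 n : 4 <= n -> n * n <= 2 ^ n.
Proof.
induction 1 as [|n le IH]; [cbn; lia|].
rewrite Nat.pow_succ_r'; nia.
Qed.

(** The choice of the constant in [guess_near_geodesic]. *)
Lemma log_beats_linear D : exists k, 2 * D <= k /\ forall t, k < t ->
  exists p, 4 * t + 4 * D <= 2 ^ p /\ D * (p + 3) < t.
Proof.
exists ((D + 1) * (4 * D + 40)); split; [nia|]; intros t lt.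
set (q := t / (D + 1)).
assert (lo : (D + 1) * q <= t) by (apply Nat.Div0.mul_div_le).
assert (hi : t < (D + 1) * (q + 1)).
{ replace (q + 1) with (S q) by lia; apply Nat.mul_succ_div_gt; lia. }
assert (big : 4 * D + 40 <= q) by nia.
exists (q - 3); split; [|replace (q - 3 + 3) with q by lia; nia].
transitivity ((q - 3) * (q - 3)); [|apply square_le_pow2; lia].
assert (e : q = (q - 3) + 3) by lia.
generalize dependent (q - 3); intros r hr; subst q; rewrite hr in *; nia.
Qed.

Context {X : graph} (conn : connected X).
Context (A : vert X -> vert X -> vert X -> Prop) (D : nat).
Hypothesis A_short : forall x y u, dn x y <= 1 -> A x y u -> u = x \/ u = y.
Hypothesis A_linked : forall x y, linked (A x y) x y.
Hypothesis A_slim : forall x y z u, A x y u ->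
  exists w, (A x z w \/ A z y w) /\ dn u w <= D.

(** Cut the path in the middle and apply slimness to the two halves: each
    halving costs [D], and a path with [2 ^ p] edges is halved [p] times. *)
Lemma guess_log (f : nat -> vert X) :
  (forall i, dn (f i) (f (S i)) <= 1) ->
  forall p i n u, n <= 2 ^ p -> A (f i) (f (i + n)) u ->
  exists j, i <= j <= i + n /\ dn u (f j) <= D * (p + 1).
Proof.
intros step; induction p as [|p IH]; intros i n u len hu.
- assert (le : dn (f i) (f (i + n)) <= 1).
  { cbn in len; destruct n as [|[|n]]; try lia.
    - now rewrite Nat.add_0_r, dn_refl.
    - rewrite Nat.add_1_r; apply step. }
  destruct (A_short _ _ _ le hu) as [-> | ->]; [exists i|exists (i + n)];
    rewrite dn_refl; lia.
- rewrite Nat.pow_succ_r' in len.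
  set (a := Nat.min n (2 ^ p)).
  destruct (A_slim _ _ (f (i + a)) _ hu) as (w & [hw|hw] & dw).
  + destruct (IH i a w) as (j & hj & dj); [lia|assumption|].
    exists j; split; [lia|]; generalize (dn_tri conn u w (f j)); lia.
  + replace (i + n) with (i + a + (n - a)) in hw by lia.
    destruct (IH (i + a) (n - a) w) as (j & hj & dj); [lia|assumption|].
    exists j; split; [lia|]; generalize (dn_tri conn u w (f j)); lia.
Qed.

(** Let [t] be the distance from a point [u] of [A x y] to the geodesic. Cutting
    the geodesic at distance about [2 t] on both sides of the point nearest to
    [u] leaves a middle piece that [guess_log] compares with [A] at logarithmic
    cost. So [t] is at most a constant times [log t]. *)
Lemma guess_near_geodesic : exists k, forall (f : nat -> vert X) N,
  (forall i, dn (f i) (f (S i)) <= 1) ->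
  (forall i j, i <= j <= N -> dn (f i) (f j) = j - i) ->
  forall n i u, i + n <= N -> A (f i) (f (i + n)) u ->
  exists j, i <= j <= i + n /\ dn u (f j) <= k.
Proof.
destruct (log_beats_linear D) as (k & kD & kp); exists k.
intros f N step geo n; induction n as [n IH] using lt_wf_ind; intros i u iN hu.
destruct (least_nat (fun t => exists j, i <= j <= i + n /\ dn u (f j) = t))
  as (t & (j & hj & ej) & least).
{ exists (dn u (f i)), i; split; auto; lia. }
destruct (le_lt_dec t k) as [le|lt]; [exists j; split; auto; lia|exfalso].
assert (far : forall j', i <= j' <= i + n -> t <= dn u (f j')).
{ intros j' hj'; apply least; eauto. }
set (R := t + 2 * D + k + 1).
set (a := Nat.max i (j - R)); set (b := Nat.min (i + n) (j + R)).
assert (geo' : forall p q, i <= p <= i + n -> i <= q <= i + n -> p + R <= q \/ q + R <= p ->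
           R <= dn (f p) (f q)).
{ intros p q hp hq [h|h]; [|rewrite (dn_sym conn)]; rewrite geo; lia. }
(* By induction [A] of an outer piece stays within [k] of that piece, whose
   distance from the point [f j] nearest to [u] is at least [R]. *)
assert (side : forall p m w, i <= p -> p + m <= i + n ->
  m = 0 \/ m < n /\ (p + m + R <= j \/ j + R <= p) ->
  A (f p) (f (p + m)) w -> dn u w <= 2 * D -> False).
{ intros p m w hp hm [->|[lm hR]] hw dw.
  - rewrite Nat.add_0_r in hw.
    destruct (A_short _ _ _ ltac:(rewrite dn_refl; lia) hw) as [-> | ->];
      generalize (far p ltac:(lia)); lia.
  - destruct (IH m lm p w) as (q & hq & dq); [lia|assumption|].
    generalize (geo' q j ltac:(lia) ltac:(lia) ltac:(lia)).
    generalize (dn_tri conn u w (f q)) (dn_tri conn (f q) u (f j)).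
    rewrite (dn_sym conn (f q) u); lia. }
destruct (A_slim _ _ (f a) _ hu) as (w & [hw|hw] & dw).
{ apply (side i (a - i) w); try lia.
  replace (i + (a - i)) with a by lia; exact hw. }
destruct (A_slim _ _ (f b) _ hw) as (v & [hv|hv] & dv);
  pose proof (dn_tri conn u w v) as tri.
- destruct (kp t lt) as (p & hp1 & hp2).
  replace b with (a + (b - a)) in hv by lia.
  destruct (guess_log f step p a (b - a) v) as (q & hq & dq); [lia|assumption|].
  generalize (far q ltac:(lia)) (dn_tri conn u v (f q)); nia.
- apply (side b (i + n - b) v); try lia.
  replace (b + (i + n - b)) with (i + n) by lia; exact hv.
Qed.

Lemma walk_function n (x y : vert X) : walk X n x y ->
  exists f : nat -> vert X, f 0 = x /\ f n = y /\
    (forall i, f i = f (S i) \/ adj X (f i) (f (S i))) /\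
    (forall i, n <= i -> f i = y).
Proof.
induction 1 as [x|n x y z a w (f & f0 & fn & fs & fc)].
- exists (fun _ => x); auto.
- exists (fun i => match i with 0 => x | S i => f i end).
  repeat split; auto.
  + intros [|i]; [right; now rewrite f0|apply fs].
  + intros [|i] le; [lia|apply fc; lia].
Qed.

Lemma geodesic_function (x y : vert X) : exists f : nat -> vert X,
  f 0 = x /\ f (dn x y) = y /\ (forall i, dn (f i) (f (S i)) <= 1) /\
  forall i j, i <= j <= dn x y -> dn (f i) (f j) = j - i.
Proof.
destruct (walk_function _ _ _ (dn_walk conn x y)) as (f & f0 & fn & fs & _).
exists f; repeat split; auto.
{ intros i; destruct (fs i) as [<-|a]; [rewrite dn_refl; lia|now apply dn_adj_le]. }
assert (lip : forall i m, dn (f i) (f (i + m)) <= m).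
{ intros i; induction m as [|m IH]; [now rewrite Nat.add_0_r, dn_refl|].
  rewrite Nat.add_succ_r; pose proof (dn_tri conn (f i) (f (i + m)) (f (S (i + m)))).
  destruct (fs (i + m)) as [<-|a]; [|apply dn_adj_le in a]; lia. }
intros i j le.
generalize (lip 0 i) (lip i (j - i)) (lip j (dn x y - j)).
replace (i + (j - i)) with j by lia.
replace (j + (dn x y - j)) with (dn x y) by lia.
cbn; rewrite f0, fn.
generalize (dn_tri conn x (f i) y) (dn_tri conn (f i) (f j) y); lia.
Qed.

Lemma guess_near_between : exists C, forall x y u, A x y u ->
  dn x u + dn u y <= dn x y + C.
Proof.
destruct guess_near_geodesic as (k & hk); exists (2 * k); intros x y u hu.
destruct (geodesic_function x y) as (f & f0 & fn & fs & geo).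
destruct (hk f (dn x y) fs geo (dn x y) 0 u) as (j & hj & dj); [lia| |].
{ cbn; now rewrite f0, fn. }
generalize (geo 0 j ltac:(lia)) (geo j (dn x y) ltac:(lia)); rewrite f0, fn.
generalize (dn_tri conn x (f j) u) (dn_tri conn u (f j) y) (dn_sym conn u (f j)).
lia.
Qed.

(** Up to a constant, the Gromov product of [x] and [z] at [w] is the distance
    from [w] to [A x z]: it is not larger because [A x z] stays near geodesics,
    and not smaller because some vertex of [A x z] is near both [A x w] and
    [A w z]. Slimness compares the distances from [w] to the three sides of a
    triangle, which is the four-point condition. *)
Lemma guess_four_point : exists E, four_point X E.
Proof.
destruct guess_near_between as (C & hC).
assert (lower : forall x z w, exists m, A x z m /\
   2 * dn w m + dn x z <= dn x w + dn w z + (4 * D + 2 + 2 * C)).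
{ intros x z w.
  set (near := fun u => exists p, A x w p /\ dn u p <= D).
  assert (H : forall m p q, A x z m -> A x w p -> dn m p <= D + 1 ->
    A w z q -> dn m q <= D + 1 -> dn m p + dn m q <= 2 * D + 1 ->
    2 * dn w m + dn x z <= dn x w + dn w z + (4 * D + 2 + 2 * C)).
  { intros m p q hm hp dp hq dq dpq.
    generalize (hC _ _ _ hp) (hC _ _ _ hq).
    generalize (dn_tri conn x p m) (dn_tri conn m p w) (dn_tri conn w q m)
      (dn_tri conn m q z) (dn_tri conn x m z) (dn_sym conn w m)
      (dn_sym conn p m) (dn_sym conn q m); lia. }
  pose proof (A_linked x z) as l.
  assert (sx : near x).
  { exists x; split; [exact (linked_start _ _ _ (A_linked x w))|]; rewrite dn_refl; lia. }
  destruct (classic (near z)) as [(p & hp & dp)|nz].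
  - exists z; split; [eapply linked_end; eauto|].
    apply (H z p z); rewrite ?dn_refl; try lia; auto.
    + exact (linked_end _ _ _ l).
    + exact (linked_end _ _ _ (A_linked w z)).
  - destruct (linked_cross _ near x z l sx nz) as (a & b & ha & hb & ab & (p & hp & dp) & nb).
    exists a; split; auto.
    destruct (A_slim _ _ w _ hb) as (q & [hq|hq] & dq).
    { destruct nb; exists q; auto. }
    generalize (dn_tri conn a b q) (dn_adj_le a b ab); intros t1 t2.
    apply (H a p q); auto; lia. }
assert (upper : forall x y w m, A x y m -> dn x w + dn y w <= dn x y + 2 * dn w m + C).
{ intros x y w m hm; generalize (hC _ _ _ hm) (dn_tri conn x m w) (dn_tri conn y m w)
    (dn_sym conn w m) (dn_sym conn y m); lia. }
exists (6 * D + 3 * C + 2); intros x z w y.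
destruct (lower x z w) as (m & hm & dm).
destruct (A_slim _ _ y _ hm) as (q & [hq|hq] & dq);
  pose proof (dn_tri conn w m q); pose proof (upper _ _ w _ hq);
  pose proof (dn_sym conn w z); pose proof (dn_sym conn w y);
  pose proof (dn_sym conn y z); lia.
Qed.

End Guessing.

(** * Projections to the subgraphs [H_c] *)

Section Avoiding.
Local Open Scope nat_scope.
Context {X : graph}.
Implicit Types x y z v : vert X.

Inductive avoiding v : nat -> vert X -> vert X -> Prop :=
| avoiding_nil x : x <> v -> avoiding v 0 x x
| avoiding_cons n x y z : x <> v -> adj X x y -> avoiding v n y z -> avoiding v (S n) x z.

Lemma avoiding_app v n m x y z :
  avoiding v n x y -> avoiding v m y z -> avoiding v (n + m) x z.
Proof. induction 1; cbn; auto; econstructor; eauto. Qed.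

Lemma avoiding_geodesic (conn : connected X) v x y : ~ btw x v y -> avoiding v (dn x y) x y.
Proof.
remember (dn x y) as n eqn:e; revert x e; induction n as [|n IH]; intros x e nb.
- symmetry in e; apply (dn_eq0 conn) in e; subst; constructor; intros ->.
  apply nb; unfold btw; now rewrite !dn_refl.
- destruct (dn_step conn x y) as (z & a & ez).
  { intros ->; rewrite dn_refl in e; lia. }
  apply avoiding_cons with z; auto.
  + intros ->; apply nb; unfold btw; rewrite dn_refl; lia.
  + apply IH; [lia|]; unfold btw in *; intros b; apply nb.
    generalize (dn_tri conn x z v) (dn_adj_le x z a) (dn_tri conn x v y); lia.
Qed.

End Avoiding.

Section Projection.
Local Open Scope nat_scope.
Context {G : graph} {C : Type} {H : C -> vert G -> Prop}.
Context (connG : connected G) (connH : forall c, connected (full_subgraph G (H c))).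

Local Notation EG := (electrification G H).
Local Notation Hg c := (full_subgraph G (H c)).
Local Notation incl a := (proj1_sig a).

Definition ver (x : vert G) : vert EG := inl x.
Local Notation emb a := (ver (incl a)).
Definition cone (c : C) : vert EG := inr c.

(** The nearest-point projection of [EG] to [H_c]. It is a relation because the
    entry point depends on the geodesic; it is coarsely well defined by
    [proj_unique]. *)
Definition proj (c : C) (x : vert EG) (a : vert (Hg c)) : Prop :=
  dn x (emb a) + 1 = dn x (cone c).

Lemma subgraph_vertex_eq c (a b : vert (Hg c)) : incl a = incl b -> a = b.
Proof.
destruct a as [a ha], b as [b hb]; cbn; intros <-; f_equal; apply proof_irrelevance.
Qed.

Lemma electrification_connected : connected EG.
Proof.
assert (W : forall n x y, walk G n x y -> walk EG n (inl x) (inl y)).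
{ intros n x y; apply (@walk_map G EG inl); auto. }
destruct (proj1 connG) as [o].
assert (W1 : forall u : vert EG, exists n, walk EG n (inl o) u).
{ intros [x|c].
  - destruct (proj2 connG o x) as [n w]; exists n; auto.
  - destruct (proj1 (connH c)) as [[x hx]].
    destruct (proj2 connG o x) as [n w]; exists (n + 1).
    apply walk_app with (inl x); [now apply W|apply walk_edge; exact hx]. }
split; [exact (inhabits (inl o))|]; intros x y.
destruct (W1 x) as [n wx], (W1 y) as [m wy]; exists (n + m).
apply walk_app with (inl o); auto; now apply walk_sym.
Qed.

Local Notation connE := electrification_connected.

Lemma dn_incl c (a b : vert (Hg c)) : dn (incl a) (incl b) <= dn a b.
Proof.
apply dn_le, (@walk_map (Hg c) G (fun a => incl a)); auto; apply (dn_walk (connH c)).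
Qed.

Lemma dn_inl (x y : vert G) : dn (ver x) (ver y) <= dn x y.
Proof.
apply dn_le, (@walk_map G EG inl); auto; apply (dn_walk connG).
Qed.

Lemma dn_emb_cone c (a : vert (Hg c)) : dn (emb a) (cone c) = 1.
Proof. apply (dn_adj connE); exact (proj2_sig a). Qed.

Lemma cone_dn_pos c (x : vert G) : 1 <= dn (ver x) (cone c).
Proof.
destruct (dn (ver x) (cone c)) eqn:e; [|lia].
apply (dn_eq0 connE) in e; discriminate.
Qed.

Lemma proj_ex c x : x <> cone c -> exists a, proj c x a.
Proof.
intros ne; destruct (dn_last connE x (cone c) ne) as ([u|c'] & adj & e).
- exists (exist _ u adj); exact e.
- destruct adj.
Qed.

Lemma proj_emb c (a : vert (Hg c)) : proj c (emb a) a.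
Proof. unfold proj; now rewrite dn_refl, dn_emb_cone. Qed.

Lemma proj_btw c x y a : btw x y (cone c) -> proj c y a -> proj c x a.
Proof.
unfold btw, proj; intros b p.
generalize (dn_tri connE x y (emb a)) (dn_tri connE x (emb a) (cone c)).
rewrite (dn_emb_cone c a); lia.
Qed.

Lemma proj_prefix c x y z a : btw x y z -> btw y (cone c) z -> proj c y a -> proj c x a.
Proof.
intros b1 b2; apply proj_btw; unfold btw in *.
generalize (dn_tri connE x y (cone c)) (dn_tri connE x (cone c) z); lia.
Qed.

(** ** Bounded angles *)

(** The only consequence of bounded penetration used below: in Bowditch's
    terminology, angles at the cone vertices are controlled by the lengths of
    detours. *)
Definition detours_bounded : Prop := forall K, exists P,
  forall c (a b : vert (Hg c)) n, n <= K ->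
    avoiding (cone c) n (emb a) (emb b) -> dn a b <= P.

Context (D : nat) (hypE : four_point EG D) (detours : detours_bounded).

Lemma proj_to_avoiding c x a : proj c x a ->
  avoiding (cone c) (dn x (emb a)) x (emb a).
Proof.
intros p; apply (avoiding_geodesic connE); unfold btw.
generalize (dn_sym connE (cone c) (emb a)); rewrite dn_emb_cone.
unfold proj in p; lia.
Qed.

Lemma proj_from_avoiding c x a : proj c x a ->
  avoiding (cone c) (dn x (emb a)) (emb a) x.
Proof.
intros p; rewrite (dn_sym connE); apply (avoiding_geodesic connE); unfold btw.
generalize (dn_sym connE x (cone c)) (dn_sym connE (emb a) x).
rewrite dn_emb_cone; unfold proj in p; lia.
Qed.

(** Prolong the walk from [x] to [y] by geodesics to the projections. *)
Lemma proj_detour K : exists P, forall c x y a b n,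
  n + dn x (cone c) + dn y (cone c) <= K -> avoiding (cone c) n x y ->
  proj c x a -> proj c y b -> dn a b <= P.
Proof.
destruct (detours K) as (P & hP); exists P; intros c x y a b n le w pa pb.
apply (hP c a b (dn x (emb a) + (n + dn y (emb b)))).
{ unfold proj in *; lia. }
eapply avoiding_app; [now apply proj_from_avoiding|].
eapply avoiding_app; [exact w|now apply proj_to_avoiding].
Qed.

(** Geodesics from [x] and [y] to [v_c] whose Gromov product at [v_c] is large
    are close to each other at some distance from [v_c], where one can cross
    from one to the other without meeting [v_c]. *)
Lemma proj_far : exists P, forall c x y a b,
  dn x y + 2 * (2 * D + 1) <= dn x (cone c) + dn y (cone c) ->
  proj c x a -> proj c y b -> dn a b <= P.
Proof.
set (r := 2 * D + 1).
destruct (proj_detour (2 * D + 2 * r)) as (P & hP); exists P.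
intros c x y a b far pa pb; set (v := cone c) in *.
assert (back : forall z (e : vert (Hg c)), proj c z e -> r <= dn z v ->
  exists z', dn z' v = r /\ dn z z' = dn z v - r /\ proj c z' e).
{ intros z e pe le; unfold proj in *.
  destruct (dn_split connE z (emb e) (dn z v - r)) as (z' & e1 & e2).
  { fold v in pe; unfold r in *; lia. }
  exists z'; fold v in pe |- *; generalize (dn_tri connE z' (emb e) v) (dn_tri connE z z' v).
  unfold v at 2; rewrite dn_emb_cone; lia. }
generalize (dn_tri connE x y v) (dn_tri connE y x v) (dn_sym connE x y); intros t1 t2 t3.
destruct (back x a pa) as (x' & ex1 & ex2 & px); [lia|].
destruct (back y b pb) as (y' & ey1 & ey2 & py); [lia|].
pose proof (dn_sym connE x x'); pose proof (dn_sym connE y y').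
pose proof (dn_sym connE y' v); pose proof (dn_sym connE x' y).
assert (h1 : dn x' y <= dn y v - r + D).
{ destruct (hypE x' y x v); lia. }
assert (h2 : dn x' y' <= 2 * D).
{ destruct (hypE x' y' y v); lia. }
apply (hP c x' y' a b (dn x' y')); auto; [fold v; lia|].
apply (avoiding_geodesic connE); unfold btw; fold v; unfold r in *; lia.
Qed.

(** Points of a geodesic far back from [m] are in the situation of [proj_far];
    the remaining segment is a short detour. *)
Lemma proj_side M : exists P, forall c x m a b,
  ~ btw x (cone c) m -> dn m (cone c) <= M -> proj c x a -> proj c m b -> dn a b <= P.
Proof.
destruct proj_far as (P1 & hP1).
set (N := M + (2 * D + 1)).
destruct (proj_detour (2 * N + 2 * M)) as (P2 & hP2); exists (P1 + P2).
intros c x m a b nb dm pa pb; set (v := cone c) in *.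
destruct (le_lt_dec (dn x m) N) as [le|lt].
- enough (dn a b <= P2) by lia.
  apply (hP2 c x m a b (dn x m)); auto.
  + fold v; generalize (dn_tri connE x m v); lia.
  + now apply (avoiding_geodesic connE).
- destruct (dn_split connE x m (dn x m - N)) as (m' & e1 & e2); [lia|].
  destruct (proj_ex c m') as (b' & pb').
  { intros ->; apply nb; unfold btw; fold v in e1, e2; lia. }
  pose proof (dn_tri connE x v m) as t1; pose proof (dn_tri connE m' v m) as t2.
  pose proof (dn_tri connE m' m v) as t3; pose proof (dn_sym connE v m) as t4.
  pose proof (dn_tri connE x m' v) as t5.
  assert (h1 : dn a b' <= P1).
  { apply (hP1 c x m'); auto; fold v; unfold N in *; lia. }
  assert (h2 : dn b' b <= P2).
  { apply (hP2 c m' m b' b (dn m' m)); auto; [fold v; lia|].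
    apply (avoiding_geodesic connE); fold v; unfold btw in *; intros bb; apply nb; lia. }
  generalize (dn_tri (connH c) a b' b); lia.
Qed.

(** The analogue of the bounded geodesic image theorem for subsurface
    projections. Either the Gromov product of [x] and [y] at [v_c] is large, or
    the geodesic has a point [m] near [v_c], and each side of [m] is treated by
    [proj_side]. *)
Lemma bounded_geodesic_image : exists B, forall c x y a b,
  ~ btw x (cone c) y -> proj c x a -> proj c y b -> dn a b <= B.
Proof.
destruct proj_far as (P1 & hP1).
destruct (proj_side (2 * (2 * D + 1) + D)) as (P2 & hP2).
exists (P1 + 2 * P2); intros c x y a b nb pa pb; set (v := cone c) in *.
destruct (le_lt_dec (dn x y + 2 * (2 * D + 1)) (dn x v + dn y v)) as [le|lt].
{ generalize (hP1 c x y a b le pa pb); lia. }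
assert (Hm : exists m, btw x m y /\ dn m v <= 2 * (2 * D + 1) + D).
{ destruct (le_lt_dec (dn x v) (dn x y)) as [le'|lt'].
  - destruct (dn_split connE x y (dn x v) le') as (m & e1 & e2).
    exists m; split; [unfold btw; lia|].
    pose proof (dn_sym connE m x); pose proof (dn_sym connE v y); pose proof (dn_sym connE v x).
    destruct (hypE m v x y); lia.
  - exists y; split; [unfold btw; rewrite dn_refl; lia|lia]. }
destruct Hm as (m & bm & dm).
destruct (proj_ex c m) as (e & pe).
{ intros ->; contradiction. }
pose proof (dn_tri connE x v m) as t1; pose proof (dn_tri connE x v y) as t2.
pose proof (dn_tri connE v m y) as t3; pose proof (dn_tri connE x m v) as t4.
pose proof (dn_sym connE v m) as s1; pose proof (dn_sym connE v y) as s2.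
pose proof (dn_sym connE y m) as s3; pose proof (dn_tri connE y m v) as t5.
assert (h1 : dn a e <= P2).
{ apply (hP2 c x m); auto; fold v; unfold btw in *; lia. }
assert (h2 : dn b e <= P2).
{ apply (hP2 c y m); auto; fold v; unfold btw in *; lia. }
generalize (dn_tri (connH c) a e b) (dn_sym (connH c) e b); lia.
Qed.

(** The two vertices have distance at most two, and the path through [v_c']
    avoids [v_c] even if some geodesic between them does not. *)
Lemma bounded_image_of_subgraph : exists B, forall c c' (u u' : vert (Hg c')) a b,
  c <> c' -> proj c (emb u) a -> proj c (emb u') b -> dn a b <= B.
Proof.
destruct bounded_geodesic_image as (B & hB); destruct (proj_detour 4) as (P & hP).
exists (B + P); intros c c' u u' a b ne pa pb.
destruct (classic (btw (emb u) (cone c) (emb u'))) as [bt|nb].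
- enough (dn a b <= P) by lia.
  assert (le2 : dn (emb u) (emb u') <= 2).
  { generalize (dn_tri connE (emb u) (cone c') (emb u')).
    rewrite (dn_sym connE (cone c')), !dn_emb_cone; lia. }
  unfold btw in bt; rewrite (dn_sym connE (cone c)) in bt.
  pose proof (cone_dn_pos c (incl u)); pose proof (cone_dn_pos c (incl u')).
    apply (hP c (emb u) (emb u') a b 2); auto; [lia|].
  apply avoiding_cons with (cone c'); [discriminate|exact (proj2_sig u)|].
  apply avoiding_cons with (emb u'); [unfold cone; congruence|exact (proj2_sig u')|].
  constructor; discriminate.
- generalize (hB c _ _ a b nb pa pb); lia.
Qed.

Context (B : nat).
Hypothesis hB : forall c x y a b,
  ~ btw x (cone c) y -> proj c x a -> proj c y b -> dn a b <= B.

Lemma proj_unique c x a b : proj c x a -> proj c x b -> dn a b <= B.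
Proof.
intros pa pb; apply (hB c x x); auto; unfold btw; rewrite dn_refl; intros e.
assert (e0 : dn x (cone c) = 0) by lia; unfold proj in pa; lia.
Qed.

(** An edge of [G] is a geodesic of [EG] that avoids all cone vertices. *)
Lemma proj_lipschitz c n x y a b : walk G n x y ->
  proj c (ver x) a -> proj c (ver y) b -> dn a b <= B * (n + 1).
Proof.
intros w; revert a; induction w as [x|n x y z adj w IH]; intros a pa pb.
- generalize (proj_unique c _ a b pa pb); lia.
- destruct (proj_ex c (ver y)) as (e & pe); [discriminate|].
  assert (h : dn a e <= B).
  { apply (hB c (ver x) (ver y)); auto; unfold btw.
    generalize (cone_dn_pos c x) (cone_dn_pos c y); rewrite (dn_sym connE (cone c)).
    assert (dn (ver x) (ver y) <= 1) by (apply dn_adj_le; exact adj); lia. }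
  generalize (IH e pe pb) (dn_tri (connH c) a e b); nia.
Qed.


(** ** Slim triangles of enlargements *)

(** The union of all enlargements of all geodesics of [EG] from [x] to [y].
    Described by betweenness, it requires no choice of geodesics, and its
    second clause contains every [H_c]-geodesic between projections of [x] and
    [y] as soon as one geodesic passes through [v_c]. *)
Definition hull (x y u : vert G) : Prop :=
  btw (ver x) (ver u) (ver y) \/
  exists c (a b w : vert (Hg c)), btw (ver x) (cone c) (ver y) /\
    proj c (ver x) a /\ proj c (ver y) b /\ btw a w b /\ incl w = u.

Lemma ver_inj x y : ver x = ver y -> x = y.
Proof. intros e; now injection e. Qed.

Lemma hull_sym x y u : hull x y u -> hull y x u.
Proof.
intros [h|(c & a & b & w & h1 & h2 & h3 & h4 & h5)]; [left|right].
- now apply (btw_sym connE).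
- exists c, b, a, w; repeat split; auto; [now apply (btw_sym connE)|].
  now apply (btw_sym (connH c)).
Qed.

Lemma hull_short x y u : dn x y <= 1 -> hull x y u -> u = x \/ u = y.
Proof.
intros le; pose proof (dn_inl x y) as le'.
intros [h|(c & a & b & w & h & _)]; unfold btw in h.
- destruct (dn (ver x) (ver u)) eqn:e1.
  + left; symmetry; now apply ver_inj, (dn_eq0 connE).
  + right; apply ver_inj, (dn_eq0 connE); lia.
- generalize (cone_dn_pos c x) (cone_dn_pos c y); rewrite (dn_sym connE (cone c)) in h; lia.
Qed.

Lemma proj_on_geodesic c x y a : btw x (cone c) y -> proj c x a -> btw x (emb a) y.
Proof.
unfold btw, proj; intros h pa.
generalize (dn_tri connE (emb a) (cone c) y) (dn_tri connE x (emb a) y).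
rewrite (dn_emb_cone c a); lia.
Qed.

Lemma hull_proj c x y a : btw (ver x) (cone c) (ver y) -> proj c (ver x) a -> hull x y (incl a).
Proof. intros h pa; left; exact (proj_on_geodesic _ _ _ _ h pa). Qed.

Lemma hull_proj_r c x y b : btw (ver x) (cone c) (ver y) -> proj c (ver y) b -> hull x y (incl b).
Proof. intros h pb; apply hull_sym, (hull_proj c); auto; now apply (btw_sym connE). Qed.

Lemma hull_extend x x' y u : btw (ver x) (ver x') (ver y) -> hull x' y u -> hull x y u.
Proof.
intros h [h'|(c & a & b & w & h1 & h2 & h3 & h4 & h5)]; [left|right].
- unfold btw in *.
  generalize (dn_tri connE (ver x) (ver x') (ver u)) (dn_tri connE (ver x) (ver u) (ver y)); lia.
- exists c, a, b, w; repeat split; auto; [|eapply proj_prefix; eauto].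
  unfold btw in *.
  generalize (dn_tri connE (ver x) (ver x') (cone c)) (dn_tri connE (ver x) (cone c) (ver y)); lia.
Qed.

Lemma hull_linked x y : linked (hull x y) x y.
Proof.
remember (dn (ver x) (ver y)) as n eqn:e; revert x e.
induction n as [n IH] using lt_wf_ind; intros x e.
assert (hx : hull x y x) by (left; unfold btw; now rewrite dn_refl).
destruct (classic (ver x = ver y)) as [exy|ne].
{ apply ver_inj in exy; subst y; constructor; auto. }
destruct (dn_step connE _ _ ne) as ([z|c] & adj & ez).
- apply linked_cons with z; auto.
  apply linked_sub with (S := hull z y).
  + intros u; apply hull_extend; unfold btw.
    change (dn (ver z) (ver y) + 1 = dn (ver x) (ver y)) in ez.
    rewrite (dn_adj connE (ver x) (ver z) adj); lia.
  + apply (IH (dn (ver z) (ver y))); auto.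
    change (dn (ver z) (ver y) + 1 = dn (ver x) (ver y)) in ez; lia.
- change (dn (cone c) (ver y) + 1 = dn (ver x) (ver y)) in ez.
  set (a := exist _ x adj : vert (Hg c)).
  destruct (proj_ex c (ver y)) as (b & pb); [discriminate|].
  assert (bt : btw (ver x) (cone c) (ver y)).
  { unfold btw; change (ver x) with (emb a); rewrite dn_emb_cone.
    change (emb a) with (ver x); lia. }
  apply linked_app with (incl b).
  + change x with (incl a) at 2.
    apply (@linked_map (Hg c) G (fun w => incl w) (fun w => btw a w b)); auto.
    * intros w hw; right; exists c, a, b, w; repeat split; auto; exact (proj_emb c a).
    * apply linked_btw, connH.
  + apply (btw_sym connE) in bt.
    pose proof (proj_on_geodesic c _ _ _ bt pb) as bt'; apply (btw_sym connE) in bt'.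
    apply linked_sub with (S := hull (incl b) y).
    * intros u; now apply hull_extend.
    * apply (IH (dn (emb b) (ver y))); auto.
      unfold proj in pb; rewrite (dn_sym connE (ver y) (cone c)) in pb.
      rewrite (dn_sym connE (emb b)); lia.
Qed.

(** If all cone vertices on a geodesic of [EG] are crossed with bounded width,
    the geodesic lifts to a path of comparable length in [G]. Otherwise the part
    up to the first wide crossing lifts; hence the bound on the distance to [a]. *)
Lemma first_wide_cone T u w :
  let n := dn (ver u) (ver w) in
  dn u w <= n * (T + 1) \/
  exists c a b, proj c (ver u) a /\ proj c (ver w) b /\ btw (ver u) (cone c) (ver w) /\
    dn u (incl a) <= n * (T + 1) /\ T < dn a b.
Proof.
cbv zeta; remember (dn (ver u) (ver w)) as n eqn:e; revert u e.
induction n as [n IH] using lt_wf_ind; intros u e.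
destruct (classic (ver u = ver w)) as [euw|ne].
{ apply ver_inj in euw; subst w; rewrite dn_refl; left; lia. }
assert (ext : forall z k l, k < n -> k = dn (ver z) (ver w) -> btw (ver u) (ver z) (ver w) ->
  dn u z <= l -> l + k * (T + 1) <= n * (T + 1) ->
  dn u w <= n * (T + 1) \/
  exists c a b, proj c (ver u) a /\ proj c (ver w) b /\ btw (ver u) (cone c) (ver w) /\
    dn u (incl a) <= n * (T + 1) /\ T < dn a b).
{ intros z k l lt ek bt dl lel.
  destruct (IH k lt z ek) as [le|(c & a & b & pa & pb & bt' & da & wide)]; [left|right].
  - generalize (dn_tri connG u z w); lia.
  - exists c, a, b; repeat split; auto.
    + eapply proj_prefix; eauto.
    + unfold btw in *.
      generalize (dn_tri connE (ver u) (ver z) (cone c)) (dn_tri connE (ver u) (cone c) (ver w)); lia.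
    + generalize (dn_tri connG u z (incl a)); lia. }
destruct (dn_step connE _ _ ne) as ([z|c] & adj & ez).
- change (dn (ver z) (ver w) + 1 = dn (ver u) (ver w)) in ez.
  apply (ext z (n - 1) 1); [lia|lia| |exact (dn_adj_le u z adj)|nia].
  unfold btw; rewrite (dn_adj connE (ver u) (ver z) adj); lia.
- change (dn (cone c) (ver w) + 1 = dn (ver u) (ver w)) in ez.
  set (a := exist _ u adj : vert (Hg c)).
  destruct (proj_ex c (ver w)) as (b & pb); [discriminate|].
  assert (bt : btw (ver u) (cone c) (ver w)).
  { unfold btw; change (ver u) with (emb a); rewrite dn_emb_cone.
    change (emb a) with (ver u); lia. }
  destruct (le_lt_dec (dn a b) T) as [le|lt].
  + pose proof (dn_incl c a b) as le'.
    apply (btw_sym connE) in bt.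
    pose proof (proj_on_geodesic c _ _ _ bt pb) as bt'; apply (btw_sym connE) in bt'.
    unfold proj in pb; rewrite (dn_sym connE (ver w) (cone c)), (dn_sym connE (ver w)) in pb.
    apply (ext (incl b) (n - 2) T); [lia|lia|auto| |nia].
    change u with (incl a); lia.
  + right; exists c, a, b; repeat split; auto; [exact (proj_emb c a)|].
    cbn; rewrite dn_refl; lia.
Qed.

Lemma btw_once (x y u v : vert EG) : btw x u y -> u <> v -> ~ btw x v u \/ ~ btw u v y.
Proof.
intros h ne.
destruct (classic (btw x v u)) as [h1|]; [right|now left]; intros h2; apply ne.
apply (dn_eq0 connE); unfold btw in *.
generalize (dn_tri connE x v y) (dn_sym connE u v); lia.
Qed.

(** A geodesic through [u] crosses [v_c] on at most one side of [u], so [a] is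
    near the projection of [x] or of [y]; likewise [b] is near that of [x] or of
    [z]. As [a] and [b] are far apart, the three corners cannot all project near
    each other, hence by [hB] one of the sides [x z] and [z y] passes through
    [v_c], and its entry or exit point is near [a]. *)
Lemma slim_at_cone c x y z u w a b :
  btw (ver x) (ver u) (ver y) -> btw (ver x) (ver w) (ver z) ->
  proj c (ver u) a -> proj c (ver w) b -> 4 * B < dn a b ->
  exists w', (hull x z w' \/ hull z y w') /\ dn (incl a) w' <= 2 * B.
Proof.
intros hu hw pa pb wide; set (v := cone c).
destruct (proj_ex c (ver x)) as (ax & px); [discriminate|].
destruct (proj_ex c (ver y)) as (ay & py); [discriminate|].
destruct (proj_ex c (ver z)) as (az & pz); [discriminate|].
assert (near : forall p q r (e f : vert (Hg c)), btw (ver p) (ver q) (ver r) ->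
  forall g, proj c (ver p) e -> proj c (ver r) f -> proj c (ver q) g ->
  dn g e <= B \/ dn g f <= B).
{ intros p q r e f bt g pe pf pg.
  destruct (btw_once _ _ _ v bt ltac:(discriminate)) as [n|n].
  - left; rewrite (dn_sym (connH c)); now apply (hB c (ver p) (ver q)).
  - right; now apply (hB c (ver q) (ver r)). }
pose proof (near x u y ax ay hu a px py pa) as na.
pose proof (near x w z ax az hw b px pz pb) as nb.
assert (goal : forall e, dn a e <= 2 * B -> hull x z (incl e) \/ hull z y (incl e) ->
  exists w', (hull x z w' \/ hull z y w') /\ dn (incl a) w' <= 2 * B).
{ intros e le he; exists (incl e); split; auto.
  generalize (dn_incl c a e); lia. }
pose proof (dn_tri (connH c) a ax az) as t1; pose proof (dn_tri (connH c) a ay az) as t2.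
pose proof (dn_tri (connH c) a ax b) as t3; pose proof (dn_tri (connH c) a az b) as t4.
pose proof (dn_sym (connH c) b ax) as s1; pose proof (dn_sym (connH c) b az) as s2.
pose proof (dn_sym (connH c) az ay) as s3; pose proof (dn_sym (connH c) az ax) as s4.
destruct (classic (btw (ver x) v (ver z))) as [xz|nxz];
destruct (classic (btw (ver z) v (ver y))) as [zy|nzy].
- destruct na as [na|na].
  + apply (goal ax); [lia|left; now apply (hull_proj c)].
  + apply (goal ay); [lia|right; now apply (hull_proj_r c)].
- pose proof (hB c _ _ _ _ nzy pz py) as czy.
  destruct na as [na|na].
  + apply (goal ax); [lia|left; now apply (hull_proj c)].
  + apply (goal az); [lia|left; now apply (hull_proj_r c)].
- pose proof (hB c _ _ _ _ nxz px pz) as cxz.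
  destruct na as [na|na].
  + apply (goal az); [lia|right; now apply (hull_proj c)].
  + apply (goal ay); [lia|right; now apply (hull_proj_r c)].
- pose proof (hB c _ _ _ _ nxz px pz) as cxz.
  pose proof (hB c _ _ _ _ nzy pz py) as czy.
  pose proof (dn_tri (connH c) a az ax) as t5; lia.
Qed.

(** Thinness in [EG] provides a vertex [w] on another side near [u] for the
    metric of [EG]. If the geodesic from [u] to [w] has no wide crossing, [w] is
    near [u] in [G]; otherwise [slim_at_cone] applies to the first one. *)
Lemma slim_vertex : exists E, forall x y z u, btw (ver x) (ver u) (ver y) ->
  exists w, (hull x z w \/ hull z y w) /\ dn u w <= E.
Proof.
set (T := 4 * B); set (N := 2 * D + 1).
exists (N * (T + 1) + 2 * B); intros x y z u hu.
assert (Hw : exists w, (btw (ver x) (ver w) (ver z) \/ btw (ver z) (ver w) (ver y)) /\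
   dn (ver u) (ver w) <= N).
{ destruct (four_point_thin connE D hypE _ _ (ver z) _ hu) as ([w|c] & hw & dw).
  - exists w; split; [exact hw|]; change (dn (ver u) (ver w) <= 2 * D) in dw; unfold N; lia.
  - change (dn (ver u) (cone c) <= 2 * D) in dw.
    assert (near : forall p q, btw (ver p) (cone c) (ver q) ->
      exists w, btw (ver p) (ver w) (ver q) /\ dn (ver u) (ver w) <= N).
    { intros p q bt; destruct (proj_ex c (ver p)) as (e & pe); [discriminate|].
      exists (incl e); split; [now apply (proj_on_geodesic c)|].
      generalize (dn_tri connE (ver u) (cone c) (emb e)).
      rewrite (dn_sym connE (cone c)), dn_emb_cone; unfold N; lia. }
    destruct hw as [hw|hw]; destruct (near _ _ hw) as (w & h1 & h2); exists w; auto. }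
destruct Hw as (w & hw & dw).
assert (leN : dn (ver u) (ver w) * (T + 1) <= N * (T + 1)) by nia.
destruct (first_wide_cone T u w) as [le|(c & a & b & pa & pb & _ & da & wide)].
- exists w; split; [destruct hw; [left|right]; now left|lia].
- assert (H' : exists w', (hull x z w' \/ hull z y w') /\ dn (incl a) w' <= 2 * B).
  { destruct hw as [hw|hw].
    - now apply (slim_at_cone c x y z u w a b).
    - apply (btw_sym connE) in hw; apply (btw_sym connE) in hu.
      destruct (slim_at_cone c y x z u w a b) as (w' & [h|h] & dw'); auto;
        exists w'; split; auto; [right|left]; now apply hull_sym. }
  destruct H' as (w' & hw' & dw'); exists w'; split; auto.
  generalize (dn_tri connG u (incl a) w'); lia.
Qed.

Context (DH : nat) (hypH : forall c, four_point (Hg c) DH).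

(** For a point inside some [H_c], use thinness of the triangle in [H_c] spanned
    by the projections of the corners. A side of it whose corners project far
    apart is part of an enlargement by [hB]; a short side can be neglected, and
    if both other sides are short, the point is near the vertex [a] of the
    geodesic of [EG]. *)
Lemma hull_slim : exists E, forall x y z u, hull x y u ->
  exists w, (hull x z w \/ hull z y w) /\ dn u w <= E.
Proof.
destruct slim_vertex as (E & hE).
exists (E + 2 * B + 2 * DH); intros x y z u [hu|(c & a & b & p & bt & pa & pb & bp & <-)].
{ destruct (hE x y z u hu) as (w & hw & dw); exists w; split; auto; lia. }
destruct (proj_ex c (ver z)) as (e & pe); [discriminate|].
(* The case of a point [q] near [p] on the side from [x]; the other case follows
   by exchanging [x] and [y]. *)
assert (side : forall x y (a b p : vert (Hg c)) q, btw (ver x) (cone c) (ver y) ->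
  proj c (ver x) a -> proj c (ver y) b -> btw a p b -> btw a q e -> dn p q <= 2 * DH ->
  exists w, (hull x z w \/ hull z y w) /\ dn (incl p) w <= E + 2 * B + 2 * DH).
{ clear x y a b p bt pa pb bp; intros x y a b p q bt pa pb bp bq dq.
  destruct (classic (btw (ver x) (cone c) (ver z))) as [xz|nxz].
  { exists (incl q); split; [left; right; exists c, a, e, q; auto|].
    generalize (dn_incl c p q); lia. }
  pose proof (hB c _ _ _ _ nxz pa pe) as cae.
  destruct (classic (btw (ver z) (cone c) (ver y))) as [zy|nzy].
  { exists (incl e); split; [right; now apply (hull_proj c)|].
    generalize (dn_incl c p e) (dn_tri (connH c) p q e); unfold btw in bq; lia. }
  pose proof (hB c _ _ _ _ nzy pe pb) as ceb.
  destruct (hE x y z (incl a)) as (w & hw & dw); [now apply (proj_on_geodesic c)|].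
  exists w; split; auto.
  generalize (dn_tri connG (incl p) (incl a) w) (dn_incl c p a) (dn_sym (connH c) p a)
    (dn_tri (connH c) a e b); unfold btw in bp; lia. }
destruct (four_point_thin (connH c) DH (hypH c) a b e p bp) as (q & [hq|hq] & dq).
- now apply (side x y a b p q).
- destruct (side y x b a p q) as (w & hw & dw); auto.
  + now apply (btw_sym connE).
  + now apply (btw_sym (connH c)).
  + now apply (btw_sym (connH c)).
  + exists w; split; auto; destruct hw; [right|left]; now apply hull_sym.
Qed.

End Projection.

(** * Distances in the realization *)

Section Realization.
Local Open Scope R_scope.

Lemma glb_bounds (E : R -> Prop) m r : (forall s, E s -> m <= s) -> E r ->
  m <= real (Glb_Rbar E) <= r.
Proof.
intros lb Er; destruct (Glb_Rbar_correct E) as [h1 h2].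
specialize (h2 (Finite m) (fun s Es => lb s Es)); specialize (h1 r Er).
destruct (Glb_Rbar E) as [g| |]; cbn in *; try tauto; split; assumption.
Qed.

Context {X : graph} (conn : connected X).

Lemma INR_dn_tri (x y z : vert X) : INR (dn x z) <= INR (dn x y) + INR (dn y z).
Proof. rewrite <- plus_INR; apply le_INR, dn_tri, conn. Qed.

Lemma dn_src_tgt (p : point X) : INR (dn (src p) (tgt p)) <= 1.
Proof.
destruct p as [x y t [e|a] ht]; cbn.
- subst; rewrite dn_refl; cbn; lra.
- change 1 with (INR 1); apply le_INR, dn_adj_le, a.
Qed.

Lemma exit_dn (p : point X) x a : exit p x a -> INR (dn (src p) x) <= a + 2 * pos p.
Proof.
generalize (dn_src_tgt p) (point_pos p); intros h1 h2.
intros [[-> ->]|[[-> ->]|[e [-> ->]]]]; rewrite ?dn_refl; cbn; lra.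
Qed.

(** As [pos] is at most one, the errors are bounded; at vertices, where it is
    zero, both bounds are equalities. *)
Lemma dist_bounds (p q : point X) :
  INR (dn (src p) (src q)) - 2 * pos p - 2 * pos q <= dist p q
    <= INR (dn (src p) (src q)) + pos p + pos q.
Proof.
apply glb_bounds.
- generalize (point_pos p) (point_pos q); intros hp hq.
  intros r [(x & y & a & b & n & ex & ey & w & ->)|[(e1 & e2 & ->)|(e1 & e2 & ->)]].
  + generalize (exit_dn p x a ex) (exit_dn q y b ey); intros d1 d2.
    apply dn_le, le_INR in w.
    generalize (INR_dn_tri (src p) x (src q)) (INR_dn_tri x y (src q)).
    rewrite (dn_sym conn y); lra.
  + rewrite e1, dn_refl; cbn; generalize (Rabs_pos (pos p - pos q)); lra.
  + generalize (dn_src_tgt p); rewrite e2.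
    generalize (Rle_abs (-(pos p - (1 - pos q)))); rewrite Rabs_Ropp; lra.
- left; exists (src p), (src q), (pos p), (pos q), (dn (src p) (src q)).
  repeat split; try (left; auto); [apply (dn_walk conn)|ring].
Qed.

Lemma dist_coarse (p q : point X) :
  INR (dn (src p) (src q)) - 4 <= dist p q <= INR (dn (src p) (src q)) + 2.
Proof. generalize (dist_bounds p q) (point_pos p) (point_pos q); lra. Qed.

Lemma vdist_dn (x y : vert X) : vdist X x y = INR (dn x y).
Proof. generalize (dist_bounds (vertex_point X x) (vertex_point X y)); cbn; unfold vdist; lra. Qed.

Lemma four_point_of_delta delta : delta_hyperbolic X delta ->
  forall D, delta <= INR D -> four_point X (2 * D).
Proof.
intros hyp D le x y z w.
generalize (hyp (vertex_point X w) (vertex_point X x) (vertex_point X z) (vertex_point X y)).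
unfold gromov_product.
repeat match goal with |- context [dist (vertex_point X ?a) (vertex_point X ?b)] =>
  change (dist (vertex_point X a) (vertex_point X b)) with (vdist X a b);
  rewrite (vdist_dn a b) end.
rewrite (dn_sym conn z y).
intros h.
assert (H : INR (dn x y) + INR (dn z w) <= INR (dn x z) + INR (dn y w) + 2 * INR D \/
            INR (dn x y) + INR (dn z w) <= INR (dn x w) + INR (dn y z) + 2 * INR D).
{ revert h; apply Rmin_case; intros h; [left|right]; lra. }
change 2 with (INR 2) in H; rewrite <- mult_INR, <- !plus_INR in H.
destruct H as [H|H]; apply INR_le in H; [left|right]; exact H.
Qed.

Lemma hyperbolic_of_four_point D : four_point X D -> hyperbolic X.
Proof.
intros hyp; exists (INR D + 20); intros w x y z; unfold gromov_product.
generalize (dist_coarse x w) (dist_coarse y w) (dist_coarse z w)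
  (dist_coarse x y) (dist_coarse y z) (dist_coarse x z).
generalize (pos_INR D); intros h0 h1 h2 h3 h4 h5 h6.
destruct (hyp (src x) (src z) (src y) (src w)) as [h|h];
  apply le_INR in h; rewrite !plus_INR in h;
  rewrite ?(dn_sym conn (src z) (src y)) in h;
  apply Rmin_case_strong; intros h7; lra.
Qed.

Lemma nat_above (r : R) : exists n, r <= INR n.
Proof.
destruct (INR_unbounded r) as [n hn]; exists n; lra.
Qed.

(** ** Simplicial paths *)

Lemma path_lipschitz (g : path X) i j : (i <= j)%nat -> (dn (g i) (g j) <= j - i)%nat.
Proof.
intros le; replace j with (i + (j - i))%nat at 1 by lia.
generalize (j - i)%nat; clear le j; induction n as [|n IH].
- rewrite Nat.add_0_r, dn_refl; lia.
- rewrite Nat.add_succ_r; pose proof (dn_tri conn (g i) (g (i + n)%nat) (g (S (i + n)))).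
  destruct (path_step g (i + n)) as [<-|a]; [|apply dn_adj_le in a]; lia.
Qed.

Definition floor (t : R) : nat := Z.to_nat (Int_part t).

Lemma floor_bounds t : 0 <= t -> INR (floor t) <= t < INR (floor t) + 1.
Proof.
intros h; unfold floor; rewrite INR_IZR_INZ.
generalize (base_Int_part t); intros [h1 h2].
assert (h3 : (-1 < Int_part t)%Z) by (apply lt_IZR; lra).
rewrite Z2Nat.id by lia; lra.
Qed.

Lemma floor_le t n : 0 <= t <= INR n -> (floor t <= n)%nat.
Proof.
intros h; generalize (floor_bounds t ltac:(lra)); intros b.
apply INR_le; lra.
Qed.

Lemma floor_INR n : floor (INR n) = n.
Proof. unfold floor; now rewrite Int_part_INR, Nat2Z.id. Qed.

Lemma geodesic_dn (g : path X) i j : geodesic g -> (i <= j <= len g)%nat ->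
  dn (g i) (g j) = (j - i)%nat.
Proof.
intros geo le.
assert (h : forall k, (k <= len g)%nat -> 0 <= INR k <= INR (len g)).
{ intros k lk; split; [apply pos_INR|apply le_INR, lk]. }
specialize (geo (INR i) (INR j) (h i ltac:(lia)) (h j ltac:(lia))).
generalize (dist_bounds (at_real g (INR i)) (at_real g (INR j))).
rewrite geo; unfold at_real; cbn [src pos].
fold (floor (INR i)) (floor (INR j)); rewrite !floor_INR.
unfold frac_part; rewrite !Int_part_INR, <- !INR_IZR_INZ.
rewrite Rabs_minus_sym, Rabs_pos_eq by (apply Rge_le, Rge_minus, Rle_ge, le_INR; lia).
intros e; apply INR_eq; rewrite minus_INR by lia; lra.
Qed.

Lemma path_dn_le (g : path X) s t : 0 <= s -> 0 <= t ->
  INR (dn (g (floor s)) (g (floor t))) <= Rabs (s - t) + 1.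
Proof.
intros hs ht.
assert (h : forall u v, 0 <= u -> 0 <= v -> (floor u <= floor v)%nat ->
  INR (dn (g (floor u)) (g (floor v))) <= Rabs (u - v) + 1).
{ intros u v hu hv le; generalize (path_lipschitz g _ _ le); intros l.
  apply le_INR in l; rewrite minus_INR in l by exact le.
  generalize (floor_bounds u hu) (floor_bounds v hv) (Rle_abs (-(u - v))).
  rewrite Rabs_Ropp; lra. }
destruct (le_lt_dec (floor s) (floor t)) as [le|lt]; [now apply h|].
rewrite (dn_sym conn), Rabs_minus_sym; apply h; auto; lia.
Qed.

Lemma quasi_geodesic_of_dn (g : path X) (L : nat) :
  (1 <= L)%nat ->
  (forall i j, (i <= j <= len g)%nat -> (j - i <= L * dn (g i) (g j) + L)%nat) ->
  quasi_geodesic (INR L + 6) g.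
Proof.
intros L1 h s t hs ht.
pose proof (le_INR _ _ L1) as L1'; cbn in L1'.
pose proof (dist_coarse (at_real g s) (at_real g t)) as b.
change (src (at_real g s)) with (g (floor s)) in b.
change (src (at_real g t)) with (g (floor t)) in b.
pose proof (path_dn_le g s t ltac:(lra) ltac:(lra)) as up.
assert (lo : Rabs (s - t) - 1 <= INR L * INR (dn (g (floor s)) (g (floor t))) + INR L).
{ assert (H : forall u v, 0 <= u <= INR (len g) -> 0 <= v <= INR (len g) -> u <= v ->
    v - u - 1 <= INR L * INR (dn (g (floor u)) (g (floor v))) + INR L).
  { intros u v hu hv le.
    generalize (floor_bounds u ltac:(lra)) (floor_bounds v ltac:(lra)); intros fu fv.
    assert (lef : (floor u <= floor v)%nat).
    { apply Nat.lt_succ_r, INR_lt; rewrite S_INR; lra. }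
    specialize (h (floor u) (floor v) (conj lef (floor_le v _ hv))).
    apply le_INR in h; rewrite minus_INR, plus_INR, mult_INR in h by exact lef; lra. }
  destruct (Rle_lt_dec s t) as [le|lt].
  - rewrite Rabs_minus_sym, Rabs_pos_eq by lra; now apply H.
  - rewrite Rabs_pos_eq, (dn_sym conn) by lra; apply H; lra. }
set (dd := INR (dn (g (floor s)) (g (floor t)))) in *.
set (r := Rabs (s - t)) in *; set (l := INR L) in *.
assert (d0 : 0 <= dd) by apply pos_INR.
assert (r0 : 0 <= r) by apply Rabs_pos.
destruct b as [b1 b2]; split.
- assert (r / (l + 6) <= dd + 2).
  { apply Rmult_le_reg_r with (l + 6); [lra|].
    unfold Rdiv; rewrite Rmult_assoc, Rinv_l, Rmult_1_r by lra; nra. }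
  lra.
- nra.
Qed.

(** The constant exceeds the length of the path, so the lower bound is void. *)
Lemma short_quasi_geodesic (g : path X) (K : nat) : (len g <= K)%nat ->
  quasi_geodesic (INR K + 7) g.
Proof.
intros le; replace (INR K + 7) with (INR (S K) + 6) by (rewrite S_INR; ring).
apply quasi_geodesic_of_dn; [lia|]; intros i j h; lia.
Qed.

End Realization.

(** * Detours around cone vertices *)

Section Detours.
Local Open Scope nat_scope.

Lemma avoiding_function {X : graph} (v : vert X) n x y : avoiding v n x y ->
  exists f : nat -> vert X, f 0 = x /\ f n = y /\
    (forall i, f i = f (S i) \/ adj X (f i) (f (S i))) /\
    (forall i, n <= i -> f i = y) /\ (forall i, f i <> v).
Proof.
induction 1 as [x ne|n x y z ne a w (f & f0 & fn & fs & fc & fv)].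
- exists (fun _ => x); repeat split; auto.
- exists (fun i => match i with 0 => x | S i => f i end).
  repeat split; auto.
  + intros [|i]; [right; now rewrite f0|apply fs].
  + intros [|i] le; [lia|apply fc; lia].
  + intros [|i]; auto.
Qed.

Lemma function_avoiding {X : graph} (v : vert X) (f : nat -> vert X) :
  (forall i, f i = f (S i) \/ adj X (f i) (f (S i))) -> (forall i, f i <> v) ->
  forall n i, exists m, m <= n /\ avoiding v m (f i) (f (i + n)).
Proof.
intros fs fv; induction n as [|n IH]; intros i.
- exists 0; rewrite Nat.add_0_r; split; auto; constructor; auto.
- destruct (IH (S i)) as (m & le & w).
  rewrite Nat.add_succ_r, <- Nat.add_succ_l.
  destruct (fs i) as [->|a]; [exists m; split; auto|].
  exists (S m); split; [lia|]; econstructor; eauto.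
Qed.

(** A shortest walk that avoids [v] has no repetitions; it will be efficient. *)
Lemma avoiding_path {X : graph} (v : vert X) n x y : avoiding v n x y ->
  exists g : path X, len g <= n /\ g 0 = x /\ g (len g) = y /\ (forall i, g i <> v) /\
    forall i j, i <= len g -> j <= len g -> g i = g j -> i = j.
Proof.
intros w; destruct (least_nat (fun n => avoiding v n x y)) as (m & wm & least); [eauto|].
destruct (avoiding_function v m x y wm) as (f & f0 & fm & fs & fc & fv).
exists (@Path X m f fs (fun k le => eq_trans (fc k le) (eq_sym fm))); cbn.
repeat split; auto.
assert (inj : forall i j, i < j -> j <= m -> f i = f j -> False).
{ intros i j lt le e.
  destruct (function_avoiding v f fs fv i 0) as (m1 & l1 & w1).
  destruct (function_avoiding v f fs fv (m - j) j) as (m2 & l2 & w2).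
  replace (j + (m - j)) with m in w2 by lia; cbn in w1.
  rewrite f0, e in w1; rewrite fm in w2.
  generalize (least _ (avoiding_app _ _ _ _ _ _ w1 w2)); lia. }
intros i j li lj e; destruct (lt_eq_lt_dec i j) as [[lt|]|lt]; auto; exfalso; eauto.
Qed.

Context {G : graph} {C : Type} {H : C -> vert G -> Prop}.
Context (connG : connected G) (connH : forall c, connected (full_subgraph G (H c))).
Local Notation EG := (electrification G H).
Local Notation Hg c := (full_subgraph G (H c)).
Local Notation incl a := (proj1_sig a).
Local Notation emb a := (ver (incl a)).

Lemma cone_path c (a b : vert (Hg c)) : exists g : path EG,
  len g = 2 /\ g 0 = emb a /\ g 1 = cone c /\ g 2 = emb b /\ efficient g.
Proof.
set (f := fun k => match k with 0 => emb a | 1 => cone c | _ => emb b end : vert EG).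
assert (fs : forall k, f k = f (S k) \/ adj EG (f k) (f (S k))).
{ intros [|[|k]]; cbn; auto; right; [exact (proj2_sig a)|exact (proj2_sig b)]. }
assert (fc : forall k, 2 <= k -> f k = f 2).
{ intros [|[|k]] le; auto; lia. }
exists (@Path EG 2 f fs fc); repeat split; auto.
intros c' [|[|i]] [|[|j]] _ _; cbn; unfold ver; congruence.
Qed.

(** Compare the path of length two through [v_c] with a shortest path avoiding
    [v_c]. Both are efficient, and both are quasi-geodesics with a constant that
    depends only on [K], as they are short. If the width at [v_c] were large,
    the second path would have to pass through [v_c]. *)
Lemma detours_of_bounded_penetration : bounded_penetration G H -> @detours_bounded G C H.
Proof.
intros bp K; pose proof (electrification_connected connG connH) as connE.
set (L := (INR (Nat.max K 2) + 7)%R).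
assert (Lpos : (0 < L)%R) by (unfold L; generalize (pos_INR (Nat.max K 2)); lra).
destruct (bp L Lpos) as (p & ppos & hp); destruct (nat_above p) as (P & hP).
exists P; intros c a b n le w.
destruct (Rlt_le_dec (vdist (Hg c) a b) p) as [lt|wide].
{ rewrite (vdist_dn (connH c)) in lt; apply INR_le; lra. }
exfalso.
destruct (cone_path c a b) as (g & lg & g0 & g1 & g2 & eff).
destruct (avoiding_path _ _ _ _ w) as (g' & lg' & g'0 & g'n & g'v & inj).
destruct (hp g eff) with (c := c) (k := 0) (x := a) (y := b) (g' := g') as [(k & _ & hk) _];
  auto.
- apply (short_quasi_geodesic connE); lia.
- repeat split; auto; lia.
- intros c' i j li lj ei ej; apply inj; congruence.
- apply (short_quasi_geodesic connE); lia.
- congruence.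
- rewrite g'n, lg, g2; reflexivity.
- exact (g'v k hk).
Qed.

End Detours.

(** * The structure of enlargements *)

Section Enlargement.
Local Open Scope nat_scope.
Context {G : graph} {C : Type} {H : C -> vert G -> Prop}.
Context (connG : connected G) (connH : forall c, connected (full_subgraph G (H c))).
Local Notation EG := (electrification G H).
Local Notation Hg c := (full_subgraph G (H c)).
Local Notation incl a := (proj1_sig a).
Local Notation emb a := (ver (incl a)).
Local Notation enl := (@enlarged G C H).
Implicit Types (s : list (vert EG)) (l : list (vert G)).

Lemma nth_path_vertices {X : graph} (g : path X) i u :
  nth_error (path_vertices g) i = Some u <-> i <= len g /\ g i = u.
Proof.
unfold path_vertices; rewrite nth_error_map.
destruct (le_lt_dec i (len g)) as [le|lt].
- rewrite (nth_error_nth' _ 0) by (rewrite length_seq; lia).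
  rewrite seq_nth by lia; cbn; split; [intros [= <-]; auto|intros [_ ->]; auto].
- rewrite (proj2 (nth_error_None _ _)) by (rewrite length_seq; lia).
  split; [discriminate|lia].
Qed.

Lemma enlarged_head s l : enl s l ->
  exists x s' l', s = inl x :: s' /\ l = x :: l'.
Proof.
destruct 1; eauto; cbn.
exists (incl (b 0)); eauto.
Qed.

Lemma nth_error_glue c (b : path (Hg c)) s l i u :
  enl (inl (@inclusion G (H c) (b (len b))) :: s) l ->
  nth_error (map (@inclusion G (H c)) (path_vertices b) ++ tl l) i = Some u ->
  (i <= len b /\ incl (b i) = u) \/
  exists i', i = len b + S i' /\ nth_error l (S i') = Some u.
Proof.
intros e; destruct (enlarged_head _ _ e) as (x & s' & l' & _ & ->).
assert (ln : length (map (@inclusion G (H c)) (path_vertices b)) = S (len b)).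
{ unfold path_vertices; now rewrite !length_map, length_seq. }
destruct (le_lt_dec i (len b)) as [le|lt]; intros hi; [left|right].
- rewrite nth_error_app1 in hi by lia.
  rewrite nth_error_map in hi.
  rewrite (proj2 (nth_path_vertices b i (b i))) in hi by auto.
  cbn in hi; injection hi as <-; auto.
- rewrite nth_error_app2 in hi by lia.
  exists (i - S (len b)); split; [lia|]; rewrite ln in hi; exact hi.
Qed.

(** An enlargement of [s] is indexed differently from [s]: [tagged s k u] records
    that a vertex [u] of it comes from the [k]-th vertex of [s]. A tag is an
    index of [s] since a vertex may occur both on [s] and in several [H_c]. *)
Definition tagged s k (u : vert G) : Prop :=
  match nth_error s k with
  | Some (inl v) => v = u
  | Some (inr c) => H c u
  | None => False
  end.

(** The width of a subpath at [v_c], the [k]-th vertex of [s], is measured from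
    the vertex at which the subpath [enters] [H_c] to the one at which it
    [leaves]; these are its own ends [u] and [u'] if these lie inside [H_c], that
    is, if [k] is their tag. *)
Definition leaves s k k2 (u' : vert G) {c} (q : vert (Hg c)) : Prop :=
  (k = k2 /\ incl q = u') \/ (k < k2 /\ nth_error s (S k) = Some (emb q)).

Definition enters s k k1 (u : vert G) {c} (p : vert (Hg c)) : Prop :=
  (k = k1 /\ incl p = u) \/
  exists k0, k = S k0 /\ k1 <= k0 /\ nth_error s k0 = Some (emb p).

Definition wide_after s W k2 (u' : vert G) : Prop :=
  exists k c (p q : vert (Hg c)), S k <= k2 /\ nth_error s k = Some (emb p) /\
    nth_error s (S k) = Some (cone c) /\ leaves s (S k) k2 u' q /\ W < dn p q.

Definition wide_between s W k1 k2 (u u' : vert G) : Prop :=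
  exists k c (p q : vert (Hg c)), k1 <= k <= k2 /\ nth_error s k = Some (cone c) /\
    enters s k k1 u p /\ leaves s k k2 u' q /\ W < dn p q.

Lemma leaves_cons v s k k2 u' c (q : vert (Hg c)) :
  leaves s k k2 u' q -> leaves (v :: s) (S k) (S k2) u' q.
Proof. intros [[-> e]|[lt e]]; [left|right]; split; auto; lia. Qed.

Lemma wide_after_cons v s W k2 u' :
  wide_after s W k2 u' -> wide_after (v :: s) W (S k2) u'.
Proof.
intros (k & c & p & q & le & e1 & e2 & lv & w); exists (S k), c, p, q.
repeat split; auto; [lia|now apply leaves_cons].
Qed.

Lemma wide_between_cons v s W k1 k2 u u' :
  wide_between s W k1 k2 u u' -> wide_between (v :: s) W (S k1) (S k2) u u'.
Proof.
intros (k & c & p & q & le & e1 & en & lv & w); exists (S k), c, p, q.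
repeat split; auto; try lia; [|now apply leaves_cons].
destruct en as [[-> e]|(k0 & -> & le' & e)]; [left|right]; auto.
exists (S k0); repeat split; auto; lia.
Qed.

Lemma wide_after_between s W k2 u u' x s' : s = inl x :: s' ->
  wide_after s W k2 u' -> wide_between s W 0 k2 u u'.
Proof.
intros -> (k & c & p & q & le & e1 & e2 & lv & w); exists (S k), c, p, q.
repeat split; auto; [lia|right; exists k; repeat split; auto; lia].
Qed.

Lemma subgraph_geodesic_dn c (b : path (Hg c)) i j :
  geodesic b -> i <= j <= len b -> dn (b i) (b j) = j - i.
Proof. apply (geodesic_dn (connH c)). Qed.

(** The case of [enlarged_between] in which the first vertex is the first vertex
    of the enlargement, needed separately because its tag has to be [0] for the
    induction to proceed. *)
Lemma enlarged_after W s l : 1 <= W -> enl s l ->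
  forall j u', nth_error l j = Some u' -> exists k2, tagged s k2 u' /\
    (j <= (k2 + 1) * W \/ wide_after s W k2 u').
Proof.
intros W1; induction 1 as [x|x v s l e IH|c b s l geo e IH]; intros j u' hj.
- destruct j as [|[|j]]; try discriminate; injection hj as <-.
  exists 0; split; [reflexivity|left; lia].
- destruct j as [|j].
  + injection hj as <-; exists 0; split; [reflexivity|left; lia].
  + destruct (IH j u' hj) as (k2 & t & h); exists (S k2); split; [exact t|].
    destruct h as [le|h]; [left; lia|right; now apply wide_after_cons].
- destruct (nth_error_glue c b s l j u' e hj) as [[le <-]|(j' & -> & hj')].
  + exists 1; split; [exact (proj2_sig (b j))|].
    destruct (le_lt_dec j W) as [le'|lt]; [left; lia|right].
    exists 0, c, (b 0), (b j); repeat split; auto; [left; auto|].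
    rewrite (subgraph_geodesic_dn c b) by (auto; lia); lia.
  + destruct (IH (S j') u' hj') as (k2 & t & h); exists (S (S k2)); split; [exact t|].
    destruct (le_lt_dec (len b) W) as [le'|lt].
    * destruct h as [le|h]; [left; lia|right; now apply wide_after_cons, wide_after_cons].
    * right; exists 0, c, (b 0), (b (len b)).
      repeat split; auto; [lia|right; split; auto; lia|].
      rewrite (subgraph_geodesic_dn c b) by (auto; lia); lia.
Qed.

(** This bounds the number of steps by the number of tags if all crossings have
    width at most [W]. *)
Lemma enlarged_between W s l : 1 <= W -> enl s l ->
  forall i j u u', i <= j -> nth_error l i = Some u -> nth_error l j = Some u' ->
  exists k1 k2, k1 <= k2 /\ tagged s k1 u /\ tagged s k2 u' /\
    (j - i <= (k2 - k1 + 1) * W \/ wide_between s W k1 k2 u u').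
Proof.
intros W1 e0; assert (e0' := e0).
assert (start : forall s l, enl s l -> forall j u u', nth_error l 0 = Some u ->
  nth_error l j = Some u' -> exists k1 k2, k1 <= k2 /\ tagged s k1 u /\ tagged s k2 u' /\
    (j <= (k2 - k1 + 1) * W \/ wide_between s W k1 k2 u u')).
{ clear s l e0 e0'; intros s l e j u u' h0 hj.
  destruct (enlarged_after W s l W1 e j u' hj) as (k2 & t & h).
  destruct (enlarged_head _ _ e) as (x & s' & l' & -> & ->); injection h0 as <-.
  exists 0, k2; repeat split; auto; [lia|].
  destruct h as [le|h]; [left; lia|right; eapply wide_after_between; eauto]. }
induction e0 as [x|x v s l e IH|c b s l geo e IH]; intros i j u u' le hi hj.
- destruct i as [|[|i]]; try discriminate.
  destruct (start _ _ e0' j u u' hi hj) as (k1 & k2 & h); exists k1, k2.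
  now rewrite Nat.sub_0_r.
- destruct i as [|i].
  + destruct (start _ _ e0' j u u' hi hj) as (k1 & k2 & h); exists k1, k2.
    now rewrite Nat.sub_0_r.
  + destruct j as [|j]; [lia|].
    destruct (IH e i j u u' ltac:(lia) hi hj) as (k1 & k2 & le' & t1 & t2 & h).
    exists (S k1), (S k2); repeat split; auto; [lia|].
    destruct h as [h|h]; [left; cbn; lia|right; now apply wide_between_cons].
- destruct (nth_error_glue c b s l i u e hi) as [[lei <-]|(i' & -> & hi')];
  destruct (nth_error_glue c b s l j u' e hj) as [[lej <-]|(j' & -> & hj')]; try lia.
  + exists 1, 1; repeat split; try exact (proj2_sig _); auto.
    destruct (le_lt_dec (j - i) W) as [le'|lt]; [left; lia|right].
    exists 1, c, (b i), (b j); repeat split; auto; [left; auto|left; auto|].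
    rewrite (subgraph_geodesic_dn c b) by (auto; lia); lia.
  + destruct (enlarged_after W _ l W1 e (S j') u' hj') as (k2 & t & h).
    exists 1, (S (S k2)); repeat split; [lia|exact (proj2_sig (b i))|exact t|].
    destruct (le_lt_dec (len b - i) W) as [le'|lt].
    * destruct h as [h|h]; [left; cbn; lia|right].
      destruct h as (k & c' & p & q & hk & e1 & e2 & lv & w).
      exists (S (S (S k))), c', p, q; repeat split; auto; try lia.
      -- right; exists (S (S k)); repeat split; auto; lia.
      -- now apply leaves_cons, leaves_cons.
    * right; exists 1, c, (b i), (b (len b)).
      repeat split; auto; [lia|left; auto|right; split; auto; lia|].
      rewrite (subgraph_geodesic_dn c b) by (auto; lia); lia.
  + destruct (IH e (S i') (S j') u u' ltac:(lia) hi' hj') as (k1 & k2 & le' & t1 & t2 & h).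
    exists (S (S k1)), (S (S k2)); repeat split; auto; [lia|].
    destruct h as [h|h]; [left; cbn; lia|right; now apply wide_between_cons, wide_between_cons].
Qed.

Lemma enlarged_vertex s l : enl s l -> forall i u, nth_error l i = Some u ->
  exists k, nth_error s k = Some (ver u) \/
    exists c (a w b : vert (Hg c)), nth_error s k = Some (emb a) /\
      nth_error s (S k) = Some (cone c) /\ nth_error s (S (S k)) = Some (emb b) /\
      btw a w b /\ incl w = u.
Proof.
induction 1 as [x|x v s l e IH|c b s l geo e IH]; intros i u hi.
- destruct i as [|[|i]]; try discriminate; injection hi as <-; exists 0; left; reflexivity.
- destruct i as [|i].
  + injection hi as <-; exists 0; left; reflexivity.
  + destruct (IH i u hi) as (k & h); exists (S k); exact h.
- destruct (nth_error_glue c b s l i u e hi) as [[le <-]|(i' & -> & hi')].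
  + exists 0; right; exists c, (b 0), (b i), (b (len b)); repeat split; auto.
    unfold btw; rewrite !(subgraph_geodesic_dn c b) by (auto; lia); lia.
  + destruct (IH (S i') u hi') as (k & h); exists (S (S k)); exact h.
Qed.

End Enlargement.

(** * Quasi-convexity and quasi-geodesics *)

Section Conclusion.
Local Open Scope nat_scope.
Context {G : graph} {C : Type} {H : C -> vert G -> Prop}.
Context (connG : connected G) (connH : forall c, connected (full_subgraph G (H c))).
Local Notation EG := (electrification G H).
Local Notation Hg c := (full_subgraph G (H c)).
Local Notation incl a := (proj1_sig a).
Local Notation ver := (@ver G C H).
Local Notation cone := (@cone G C H).
Local Notation hull := (@hull G C H).
Local Notation emb a := (ver (incl a)).
Local Notation connE := (electrification_connected connG connH).

(** Two vertices of [H_c] at distance two in [EG] are joined by the geodesic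
    through [v_c]; at a smaller distance they are equal or adjacent. *)
Lemma subgraph_geodesic_in_hull c (a b w : vert (Hg c)) :
  btw a w b -> hull (incl a) (incl b) (incl w).
Proof.
intros bt.
assert (le2 : dn (emb a) (emb b) <= 2).
{ generalize (dn_tri connE (emb a) (cone c) (emb b)).
  rewrite (dn_sym connE (cone c)), !(dn_emb_cone connG connH c); lia. }
destruct (Nat.eq_dec (dn (emb a) (emb b)) 2) as [e|ne].
- right; exists c, a, b, w; repeat split; auto; try apply (proj_emb connG connH).
  unfold btw; rewrite (dn_sym connE (cone c)), !(dn_emb_cone connG connH c); lia.
- assert (le1 : dn a b <= 1).
  { destruct (dn (emb a) (emb b)) as [|[|n]] eqn:e; [| |lia].
    - apply (dn_eq0 connE), ver_inj, subgraph_vertex_eq in e; subst b; rewrite dn_refl; lia.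
    - apply dn_adj_le; exact (dn_eq1 connE _ _ e). }
  left; unfold btw in bt.
  assert (w = a \/ w = b) as [-> | ->].
  { destruct (dn a w) eqn:e; [left; symmetry; now apply (dn_eq0 (connH c))|right].
    apply (dn_eq0 (connH c)); lia. }
  + unfold btw; now rewrite dn_refl.
  + unfold btw; rewrite dn_refl; lia.
Qed.

Context (C0 : nat) (hull_between : forall x y u, hull x y u ->
  dn x u + dn u y <= dn x y + C0).
Context (DG : nat) (hypG : four_point G DG).

Lemma subgraph_near c (a b : vert (Hg c)) u N :
  dn (incl a) u + dn u (incl b) <= dn (incl a) (incl b) + N ->
  exists w : vert (Hg c), dn u (incl w) <= 2 * Nat.max C0 N + DG.
Proof.
intros hu.
destruct (four_point_linked_near connG DG hypG
  (fun v => exists w : vert (Hg c), btw a w b /\ incl w = v) (incl a) (incl b) u (Nat.max C0 N))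
  as (v & (w & _ & <-) & dv).
- intros v (w & bt & <-); generalize (hull_between _ _ _ (subgraph_geodesic_in_hull c a b w bt)); lia.
- apply (@linked_map (Hg c) G (fun w => incl w) (fun w => btw a w b)); eauto.
  apply linked_btw, connH.
- lia.
- exists w; now rewrite (dn_sym connG).
Qed.

Lemma subgraph_points_near c (p : point G) : subgraph_points (H c) p ->
  exists a : vert (Hg c), dn (src p) (incl a) <= 1.
Proof.
intros [h1 h2]; destruct (Rlt_le_dec (pos p) 1) as [lt|le].
- exists (exist _ (src p) (h1 lt)); cbn; rewrite dn_refl; lia.
- exists (exist _ (tgt p) (h2 ltac:(lra))); cbn.
  apply INR_le, (dn_src_tgt p).
Qed.

Lemma subgraph_quasi_convex :
  exists k : R, (0 < k)%R /\ forall c, quasi_convex k (subgraph_points (H c)).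
Proof.
set (K := 2 * Nat.max C0 14 + DG).
exists (INR K + 2)%R; split; [generalize (pos_INR K); lra|].
intros c l g l0 geo h0 hl t ht.
destruct (subgraph_points_near c _ h0) as (a & da).
destruct (subgraph_points_near c _ hl) as (b & db).
destruct (subgraph_near c a b (src (g t)) 14) as (w & dw).
{ assert (e0 := geo 0%R l ltac:(lra) ltac:(lra)).
  assert (e1 := geo 0%R t ltac:(lra) ltac:(lra)).
  assert (e2 := geo t l ltac:(lra) ltac:(lra)).
  rewrite Rabs_minus_sym, Rabs_pos_eq in e0, e1, e2 by lra.
  generalize (dist_coarse connG (g 0%R) (g l)) (dist_coarse connG (g 0%R) (g t))
    (dist_coarse connG (g t) (g l)); rewrite e0, e1, e2; intros i0 i1 i2.
  assert (i : (INR (dn (src (g 0%R)) (src (g t)) + dn (src (g t)) (src (g l)))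
             <= INR (dn (src (g 0%R)) (src (g l)) + 10))%R).
  { rewrite !plus_INR; cbn [INR]; lra. }
  apply INR_le in i.
  generalize (dn_tri connG (incl a) (src (g 0%R)) (src (g t)))
    (dn_tri connG (src (g t)) (src (g l)) (incl b))
    (dn_tri connG (src (g 0%R)) (incl a) (src (g l)))
    (dn_tri connG (incl a) (incl b) (src (g l)))
    (dn_sym connG (incl a) (src (g 0%R))) (dn_sym connG (incl b) (src (g l))); lia. }
exists (vertex_point G (incl w)); split.
- split; cbn; intros _; exact (proj2_sig w).
- generalize (dist_coarse connG (g t) (vertex_point G (incl w))); cbn [src vertex_point].
  apply le_INR in dw; fold K in dw; lra.
Qed.

(** ** Enlargements are quasi-geodesics *)

Context (B : nat) (hB : forall c x y (a b : vert (Hg c)),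
  ~ btw x (cone c) y -> proj c x a -> proj c y b -> dn a b <= B).
Context (B' : nat) (hB' : forall c c' (u u' : vert (Hg c')) (a b : vert (Hg c)),
  c <> c' -> proj c (emb u) a -> proj c (emb u') b -> dn a b <= B').

(** If [u] lies in [H_c1] and [t] is [v_c1], a geodesic from [t] to [H_c] leaves
    [t] through another vertex of [H_c1]; apply [hB'] to it and [u]. *)
Lemma proj_of_tagged c (t : vert EG) (u : vert G) (p : vert (Hg c)) :
  match t with inl v => v = u | inr c1 => H c1 u end -> proj c t p ->
  exists e, proj c (ver u) e /\ dn e p <= B'.
Proof.
destruct t as [v|c1]; intros tu pt.
- subst v; exists p; split; auto; rewrite dn_refl; lia.
- change (proj c (cone c1) p) in pt.
  assert (ne : cone c1 <> emb p) by discriminate.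
  destruct (dn_step connE _ _ ne) as ([e1|c2] & adj1 & de); [|destruct adj1].
  change (dn (ver e1) (emb p) + 1 = dn (cone c1) (emb p)) in de.
  set (e2 := exist _ e1 adj1 : vert (Hg c1)).
  destruct (proj_ex connG connH c (ver u)) as (e & pe); [discriminate|].
  exists e; split; auto.
  apply (hB' c c1 (exist _ u tu) e2); auto.
  + intros <-; unfold proj in pt; rewrite dn_refl in pt; lia.
  + unfold proj in *; change (emb e2) with (ver e1).
    generalize (dn_tri connE (cone c1) (ver e1) (cone c)) (dn_tri connE (ver e1) (emb p) (cone c)).
    rewrite (dn_sym connE (cone c1) (ver e1)).
    change (ver e1) with (emb e2); rewrite !(dn_emb_cone connG connH).
    change (emb e2) with (ver e1); lia.
Qed.

(** The projections to [H_c] are Lipschitz on [G], so the subpath between two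
    points at distance at most [M] has bounded width at every [v_c]; its number
    of tags is bounded by the distance in [EG]. *)
Lemma enlargement_proper M : exists F, forall (g : path EG) (h : path G),
  geodesic g -> enlargement g h -> forall i j, i <= j <= len h ->
  dn (h i) (h j) <= M -> j - i <= F.
Proof.
set (W := 2 * B' + B * (M + 1) + 1); exists ((M + 3) * W).
intros g h geo enl i j le dM.
assert (tg : forall k u, tagged (path_vertices g) k u -> k <= len g /\
  match g k with inl v => v = u | inr c1 => H c1 u end).
{ intros k u; unfold tagged; destruct (nth_error _ k) as [t|] eqn:e; [|tauto].
  apply nth_path_vertices in e as [l <-]; auto. }
destruct (enlarged_between connH W _ _ ltac:(unfold W; lia) enl i j (h i) (h j))
  as (k1 & k2 & le12 & t1 & t2 & hW); [lia|apply nth_path_vertices; split; auto; lia..|].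
apply tg in t1 as [_ t1], t2 as [l2 t2].
destruct hW as [hW|(k & c & p & q & hk & ek & en & lv & w)].
- assert (near : forall (t : vert EG) u,
    match t with inl v => v = u | inr c1 => H c1 u end -> dn t (ver u) <= 1).
  { intros [v|c1] u hu; [subst; change (inl u : vert EG) with (ver u); rewrite dn_refl; lia|].
    apply dn_adj_le; exact hu. }
  pose proof (geodesic_dn connE g k1 k2 geo ltac:(lia)) as ed.
  pose proof (near _ _ t1) as n1; pose proof (near _ _ t2) as n2.
  pose proof (dn_inl (H := H) connG (h i) (h j)) as n3.
  rewrite (dn_sym connE) in n2.
  pose proof (dn_tri connE (g k1) (ver (h i)) (g k2)).
  pose proof (dn_tri connE (ver (h i)) (ver (h j)) (g k2)).
  assert (k2 - k1 + 1 <= M + 3) by lia; nia.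
- exfalso.
  apply nth_path_vertices in ek as [lk ek].
  assert (ep : exists e, proj c (ver (h i)) e /\ dn e p <= B').
  { destruct en as [[_ <-]|(k0 & -> & le0 & e0)].
    - exists p; split; [apply (proj_emb connG connH)|rewrite dn_refl; lia].
    - apply nth_path_vertices in e0 as [_ e0].
      apply (proj_of_tagged c (g k1)); auto; unfold proj; rewrite <- e0.
      rewrite <- ek.
      rewrite !(geodesic_dn connE g) by (auto; lia); lia. }
  assert (eq : exists e, proj c (ver (h j)) e /\ dn e q <= B').
  { destruct lv as [[_ <-]|[lt e0]].
    - exists q; split; [apply (proj_emb connG connH)|rewrite dn_refl; lia].
    - apply nth_path_vertices in e0 as [_ e0].
      apply (proj_of_tagged c (g k2)); auto; unfold proj; rewrite <- e0.
      rewrite <- ek.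
      rewrite !(dn_sym connE (g k2)), !(geodesic_dn connE g) by (auto; lia); lia. }
  destruct ep as (e & pe & de), eq as (f & pf & df).
  pose proof (proj_lipschitz connG connH B hB c _ _ _ e f (dn_walk connG (h i) (h j)) pe pf) as lip.
  pose proof (dn_tri (connH c) p e q); pose proof (dn_tri (connH c) e f q).
  rewrite (dn_sym (connH c) e p) in de.
  assert (B * (dn (h i) (h j) + 1) <= B * (M + 1)) by nia.
  unfold W in w; lia.
Qed.

Lemma enlargement_in_hull (g : path EG) (h : path G) x y : geodesic g ->
  g 0 = ver x -> g (len g) = ver y -> enlargement g h ->
  forall i, i <= len h -> hull x y (h i).
Proof.
intros geo g0 gn enl i le.
destruct (enlarged_vertex connH _ _ enl i (h i)) as (k & hk).
{ now apply nth_path_vertices. }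
destruct hk as [hk|(c & a & w & b & e1 & e2 & e3 & bt & <-)].
- apply nth_path_vertices in hk as [lk ek]; left; unfold btw.
  rewrite <- ek, <- g0, <- gn, !(geodesic_dn connE g) by (auto; lia); lia.
- apply nth_path_vertices in e1 as [l1 e1], e2 as [l2 e2], e3 as [l3 e3].
  change (inr c : vert EG) with (cone c) in e2.
  right; exists c, a, b, w; unfold btw at 1, proj; rewrite <- e1, <- e2, <- e3, <- g0, <- gn.
  rewrite !(dn_sym connE (g (len g))), !(geodesic_dn connE g) by (auto; lia).
  repeat split; auto; lia.
Qed.

Lemma nat_intermediate (f : nat -> nat) v :
  (forall i, f (S i) <= f i + 1 /\ f i <= f (S i) + 1) ->
  forall n i, (f i <= v <= f (i + n) \/ f (i + n) <= v <= f i) ->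
  exists l, l <= i + n /\ f l = v.
Proof.
intros step; induction n as [|n IH]; intros i hv.
- exists i; rewrite Nat.add_0_r in *; split; lia.
- destruct (Nat.eq_dec (f (i + S n)) v) as [e|ne]; [exists (i + S n); auto|].
  destruct (IH i) as (l & le & e); [|exists l; split; auto; lia].
  generalize (step (i + n)); rewrite Nat.add_succ_r in *; lia.
Qed.

(** On a hull the distance from [x] determines the position up to a bounded
    error, and along the enlargement it takes all intermediate values. By
    properness, two points of the enlargement whose distances from [x] differ by
    at most one have nearby parameters; summing over the intermediate values
    bounds the parameter difference of any two points. *)
Lemma enlargement_quasi_geodesic : exists L' : R, (1 <= L')%R /\
  forall (g : path EG) (x y : vert G),
    geodesic g -> g 0 = ver x -> g (len g) = ver y ->
    forall h : path G, enlargement g h -> quasi_geodesic L' h.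
Proof.
destruct (enlargement_proper (1 + C0 + DG)) as (F & hF).
exists (INR (S F) + 6)%R; split; [generalize (pos_INR (S F)); lra|].
intros g x y geo g0 gn h enl.
apply (quasi_geodesic_of_dn connG); [lia|]; intros i j le.
set (lev := fun i => dn x (h i)).
assert (same : forall i j, i <= len h -> j <= len h -> lev i <= lev j + 1 -> lev j <= lev i + 1 ->
  i <= j + F /\ j <= i + F).
{ clear i j le; intros i j hi hj l1 l2.
  pose proof (four_point_same_level connG DG hypG x y (h i) (h j) C0
    (hull_between _ _ _ (enlargement_in_hull g h x y geo g0 gn enl i hi))
    (hull_between _ _ _ (enlargement_in_hull g h x y geo g0 gn enl j hj))) as d.
  fold (lev i) (lev j) in d.
  assert (d' : dn (h i) (h j) <= 1 + C0 + DG) by (destruct le_lt_dec; lia).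
  destruct (le_lt_dec i j) as [lij|lji].
  - generalize (hF g h geo enl i j ltac:(lia) d'); lia.
  - rewrite (dn_sym connG) in d'; generalize (hF g h geo enl j i ltac:(lia) d'); lia. }
assert (chain : forall s i j, i <= len h -> j <= len h -> lev j = lev i + s ->
  i <= j + F * (s + 1) /\ j <= i + F * (s + 1)).
{ clear i j le; induction s as [|s IH]; intros i j hi hj e.
  - generalize (same i j hi hj); lia.
  - assert (ex : exists l, l <= len h /\ lev l = lev i + s).
    { assert (st : forall i, lev (S i) <= lev i + 1 /\ lev i <= lev (S i) + 1).
      { intros k; unfold lev.
        generalize (path_lipschitz connG h k (S k) ltac:(lia))
          (dn_tri connG x (h k) (h (S k))) (dn_tri connG x (h (S k)) (h k))
          (dn_sym connG (h k) (h (S k))); lia. }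
      destruct (nat_intermediate lev (lev i + s) st (Nat.max i j - Nat.min i j) (Nat.min i j))
        as (l & ll & el).
      - replace (Nat.min i j + (Nat.max i j - Nat.min i j)) with (Nat.max i j) by lia.
        destruct (le_lt_dec i j).
        + rewrite Nat.min_l, Nat.max_r by lia; lia.
        + rewrite Nat.min_r, Nat.max_l by lia; lia.
      - exists l; split; auto; lia. }
    destruct ex as (l & ll & el).
    generalize (IH i l hi ll el) (same l j ll hj); nia. }
pose proof (dn_tri connG x (h i) (h j)) as t1; pose proof (dn_tri connG x (h j) (h i)) as t2.
rewrite (dn_sym connG (h j)) in t2; fold (lev i) (lev j) in t1, t2.
destruct (le_lt_dec (lev i) (lev j)) as [l|l].
- generalize (chain (lev j - lev i) i j ltac:(lia) ltac:(lia) ltac:(lia)); nia.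
- generalize (chain (lev i - lev j) j i ltac:(lia) ltac:(lia) ltac:(lia)); nia.
Qed.

End Conclusion.

Theorem theorem2p4 (G : graph) (C : Type) (H : C -> vert G -> Prop) (delta : R) :
  connected G ->
  countable C ->
  (forall c : C, connected (full_subgraph G (H c))) ->
  relatively_hyperbolic G H ->
  0 < delta ->
  (forall c : C, delta_hyperbolic (full_subgraph G (H c)) delta) ->
  hyperbolic G /\
  (exists L' : R, 1 <= L' /\
     forall (g : path (electrification G H)) (x y : vert G),
       geodesic g -> g 0%nat = inl x -> g (len g) = inl y ->
       forall h : path G, enlargement g h -> quasi_geodesic L' h) /\
  (exists k : R, 0 < k /\
     forall c : C, quasi_convex k (subgraph_points (H c))).
Proof.
intros connG _ connH [[deltaE hypE] penetration] _ hypH.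
pose proof (electrification_connected connG connH) as connE.
destruct (nat_above deltaE) as (DE & leE); destruct (nat_above delta) as (DH & leH).
apply (four_point_of_delta connE) with (D := DE) in hypE; [|exact leE].
assert (fourH : forall c, four_point (full_subgraph G (H c)) (2 * DH)).
{ intros c; now apply (four_point_of_delta (connH c) delta). }
pose proof (detours_of_bounded_penetration connG connH penetration) as detours.
destruct (bounded_geodesic_image connG connH _ hypE detours) as (B & hB).
destruct (bounded_image_of_subgraph connG connH _ hypE detours) as (B' & hB').
destruct (hull_slim connG connH _ hypE B hB _ fourH) as (E & slim).
pose proof (hull_short connG connH) as short.
pose proof (hull_linked connG connH) as linkedH.
destruct (guess_near_between connG _ E short slim) as (C0 & between).
destruct (guess_four_point connG _ E short linkedH slim) as (DG & hypG).
split; [exact (hyperbolic_of_four_point connG DG hypG)|split].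
- exact (enlargement_quasi_geodesic connG connH C0 between DG hypG B hB B' hB').
- exact (subgraph_quasi_convex connG connH C0 between DG hypG).
Qed.
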